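(* Let $F(y)=\sum_{j=0}^n a_j y^j$ be a polynomial with complex coefficients of degree $n$ (so $a_n\neq 0$), and let $k_F=\jmath_F\circ\iota$ be the associated birational map of the plane. If $n$ is even, then for generic parameters $(a_0,\dots,a_n)$ the degree complexity $\delta(k_F)$ is the largest root of the polynomial $x^2-(n+1)x-1$. If $n$ is odd, then for generic parameters $(a_0,\dots,a_n)$ the degree complexity $\delta(k_F)$ is the largest root of the polynomial $x^3-nx^2-(n+1)x-1$.
   Context: For a polynomial $F\in\mathbf{C}[y]$ define the birational involutions of $\mathbf{C}^2$ $$\jmath_F(x,y)=(-x+F(y),\,y),\qquad \iota(x,y)=\left(1-x-\frac{x-1}{y},\ -y-1-\frac{y}{x-1}\right),$$ and $k_F=\jmath_F\circ\iota$, viewed as a birational map of $\mathbf{P}^2$ via $(x,y)\leftrightarrow[1:x:y]$. The degree $\deg(f)$ of a rational map $f=[f_0:f_1:f_2]$ of $\mathbf{P}^2$ is the common degree of the homogeneous polynomials $f_0,f_1,f_2$ when these have no common factor. The degree complexity is $\delta(k)=\lim_{m\to\infty}(\deg(k^m))^{1/m}$, where $k^m$ is the $m$-th iterate. ''For generic parameters'' means: for each fixed $n$, for all $(a_0,\dots,a_n)\in\mathbf{C}^{n+1}$ with $a_n\ne0$ outside some countable union of proper algebraic subsets of the parameter space. *)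

(* Defs.v *)
From mathcomp Require Import all_boot all_order all_algebra fraction.
From mathcomp Require Import complex.
From mathcomp Require Import -(notations) mpoly.
From mathcomp Require Import boolp classical_sets reals topology normedtype.
From mathcomp Require Import sequences exp.

Set Implicit Arguments.
Unset Strict Implicit.
Unset Printing Implicit Defensive.

Import Order.TTheory GRing.Theory Num.Theory.
Import numFieldNormedType.Exports.

Local Open Scope classical_set_scope.
Local Open Scope ring_scope.
Local Open Scope complex_scope.

(* The notations of mpoly clash with those of the topology files, hence the
   filtered import above; these are the only ones needed. *)
Notation "{ 'mpoly' T [ n ] }" := (mpoly n T)
  (at level 0, T at level 2, format "{ 'mpoly'  T [ n ] }") : type_scope.
Notation mvar i := (@mpolyX _ _ (mnm1 i)).

Section BirationalMaps.

Variable R : realType.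
Local Notation C := R[i].

(* The function field C(x, y) of the plane. *)
Definition ratfun := {fraction {mpoly C[2]}}.

Definition ratconst (c : C) : ratfun :=
  FracField.tofrac (@mpolyC 2 C c).
Definition xcoord : ratfun := FracField.tofrac (mvar (0 : 'I_2)).
Definition ycoord : ratfun := FracField.tofrac (mvar (1 : 'I_2)).

(* A rational self-map of the plane, in the affine chart [1 : x : y], is the
   pair of its coordinate functions, that is, its value at the generic point
   (xcoord, ycoord).  A self-map g given by formulas acts on such pairs by
   f |-> g \o f (formulas are applied to the coordinates of f).
   The maps below being birational, no denominator vanishes on the iterates of
   the generic point, so the convention 0^-1 = 0 plays no role. *)
Definition ratmap := (ratfun * ratfun)%type.

Definition jmath_map (F : {poly C}) (f : ratmap) : ratmap :=
  let: (x, y) := f in (- x + (map_poly ratconst F).[y], y).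

Definition iota_map (f : ratmap) : ratmap :=
  let: (x, y) := f in
  (1 - x - (x - 1) / y, - y - 1 - y / (x - 1)).

Definition kmap (F : {poly C}) : ratmap -> ratmap := jmath_map F \o iota_map.

Definition kmap_iter (F : {poly C}) (m : nat) : ratmap :=
  iter m (kmap F) (xcoord, ycoord).

Definition dehomogenize (p : {mpoly C[3]}) : ratfun :=
  FracField.tofrac
    (comp_mpoly [tuple 1; mvar (0 : 'I_2); mvar (1 : 'I_2)] p).

Definition no_common_factor (f : 'I_3 -> {mpoly C[3]}) : Prop :=
  forall h, (forall i, exists q, f i = q * h) -> h \is a GRing.unit.

(* [f 0 : f 1 : f 2] is a presentation, in lowest terms and of degree d, of
   the rational map of the projective plane induced by phi. *)
Definition projective_presentation
    (phi : ratmap) (d : nat) (f : 'I_3 -> {mpoly C[3]}) : Prop :=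
  [/\ forall i, f i \is ishomog1 d mdeg,
      no_common_factor f,
      dehomogenize (f 0) != 0,
      phi.1 = dehomogenize (f 1) / dehomogenize (f 0)
    & phi.2 = dehomogenize (f 2) / dehomogenize (f 0)].

(* Such a d exists and is unique, so the default value 0 is never used. *)
Definition ratmap_degree (phi : ratmap) : nat :=
  xget 0%N [set d | exists f, projective_presentation phi d f].

Definition degree_roots (F : {poly C}) : R^nat :=
  fun m => (ratmap_degree (kmap_iter F m))%:R `^ m%:R^-1.

Definition degree_complexity (F : {poly C}) : R := limn (degree_roots F).

Definition poly_of_coefs (n : nat) (a : 'I_n.+1 -> C) : {poly C} :=
  \sum_(j < n.+1) a j *: 'X^j.

Definition algebraic_subset (n : nat) (A : set ('I_n.+1 -> C)) : Prop :=
  exists S : set {mpoly C[n.+1]},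
    A = [set a | forall p, S p -> meval a p = 0].

(* P holds for all (a_0, ..., a_n) with a_n != 0 outside some countable union
   of proper algebraic subsets of C^(n+1). *)
Definition for_generic_parameters
    (n : nat) (P : ('I_n.+1 -> C) -> Prop) : Prop :=
  exists A : nat -> set ('I_n.+1 -> C),
    (forall i, algebraic_subset (A i) /\ A i <> setT) /\
    (forall a, a ord_max != 0 -> ~ (\bigcup_i A i) a -> P a).

Definition largest_root (p : {poly R}) (r : R) : Prop :=
  root p r /\ forall s, root p s -> s <= r.

End BirationalMaps.

(* Main.v *)
From HB Require Import structures.
Require Import Defs.
From mathcomp Require Import all_boot all_order all_algebra.
From mathcomp Require Import fraction complex ring lra zify.
From mathcomp Require Import -(notations) mpoly.
From mathcomp Require Import boolp classical_sets functions reals topology normedtype.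
From mathcomp Require Import sequences exp.

(* Put u = x - 1 and H = F - 1. Then k_F sends (u, y) to (u', y') with
   y' = - (y + 1 + y / u) and u' = H(y') + u (1 + 1 / y). The degree of an iterate
   is counted by its poles. A zero of u becomes a simple pole of y, after which
   y keeps its pole and u has a pole of order n at each step if n is even, and
   of orders n, n - 1, n, n - 1, ... if n is odd. A zero of y becomes a pole of u
   with y = -1 and then a zero of y again. As u has as many zeros as poles, the
   number A_m of poles of y satisfies, up to an additive constant,
   A_(m+1) = (n+1) A_m + A_(m-1) for n even and
   A_(m+1) = n A_m + (n+1) A_(m-1) + A_(m-2) for n odd.
   The upper bound comes from polynomials representing the iterates in which the
   forced common factors are cancelled; it holds for all parameters. For the
   lower bound, the numerator T and the denominator D of y are restricted to a
   line y = const, where the degree of D is computed from the behaviour at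
   infinity and T, D are shown to have no common zero by following the orbit of
   each point. This needs only that the orbits on the lines y = 0 and y = infinity
   avoid the points of indeterminacy, which is a countable family of polynomial
   conditions on the parameters. *)

Set Implicit Arguments.
Unset Strict Implicit.
Unset Printing Implicit Defensive.

Import Order.TTheory GRing.Theory Num.Theory.
Import numFieldNormedType.Exports.
Local Open Scope classical_set_scope.
Local Open Scope ring_scope.

(** * The recursion on numerators and denominators *)

(** Parity matters only at y = infinity. For n > 0 and u with a pole there, y' is asymptotic to - y;
    if u is asymptotic to c y^n, then u' = H(y') + u (1 + 1/y) gives u' / y'^n the limit h_n +
    (-1)^n c. Starting from u = 0, this coefficient runs through the multiples of h_n when n is even
    and alternates between h_n and 0 when n is odd. In the odd case the leading terms cancel, the
    numerators acquire a common factor, and an upper bound without its removal would be too large;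
    this is why there are two recursions. The removal is done by explicit quotients, so that a step
    involves no division. A state can then be specialised to a line or to a point, even where a
    denominator vanishes, and the same recursion still describes it. *)

Definition homog_eval (A : pzSemiRingType) (n : nat) (h : nat -> A) (t d : A) : A :=
  \sum_(j < n.+1) h j * t ^+ j * d ^+ (n - j).

Lemma homog_eval_rmorph (A B : pzSemiRingType) (f : {rmorphism A -> B}) n h t d :
  f (homog_eval n h t d) = homog_eval n (f \o h) (f t) (f d).
Proof.
by rewrite /homog_eval rmorph_sum; apply: eq_bigr => j _; rewrite !rmorphM !rmorphXn.
Qed.

Lemma homog_evalx0 (A : nzSemiRingType) n (h : nat -> A) t :
  homog_eval n h t 0 = h n * t ^+ n.
Proof.
rewrite /homog_eval big_ord_recr /= big1 ?add0r ?subnn ?expr0 ?mulr1 // => j _.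
by rewrite expr0n subn_eq0 leqNgt ltn_ord mulr0.
Qed.

Lemma homog_eval0x (A : nzSemiRingType) n (h : nat -> A) d :
  homog_eval n h 0 d = h 0%N * d ^+ n.
Proof.
rewrite /homog_eval big_ord_recl /= big1 ?addr0 ?subn0 ?expr0 ?mulr1 // => j _.
by rewrite exprS mul0r mulr0 mul0r.
Qed.

(* A point (u, y) = (N / (M T'), T / D) of an orbit, where u = x - 1, T' is the T
   of the preceding point and M E = D^n. For n even E = 1. For n odd D = E P,
   and u has a pole of order n - 1 at the zeros of E and of order n at the zeros
   of P; P is the next E. The fields W = (T + D) / T' and
   X = (N E - T' H(T, D)) / P make the divisions of the recursion explicit. *)
Record kstate (A : Type) := KState
  { kT : A; kT' : A; kD : A; kE : A; kP : A; kM : A; kN : A; kW : A; kX : A }.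

Definition kstate_map (A B : Type) (f : A -> B) (s : kstate A) : kstate B :=
  KState (f (kT s)) (f (kT' s)) (f (kD s)) (f (kE s)) (f (kP s)) (f (kM s))
    (f (kN s)) (f (kW s)) (f (kX s)).

Section Recursion.

Variables (A : comNzRingType) (n : nat) (h : nat -> A).
Implicit Type s : kstate A.

Definition nextD s := kD s * kN s.
Definition nextW s := - (kN s + kT' s * kM s).
Definition nextT s := kT s * nextW s - nextD s.

Definition even_init (u y : A) := KState y 1 1 1 1 1 u (y + 1) 0.

Definition even_step s :=
  KState (nextT s) (kT s) (nextD s) 1 1 (nextD s ^+ n)
    (kT s * homog_eval n h (nextT s) (nextD s) + kN s ^+ n.+1 * kW s)
    (nextW s) 0.

Definition odd_init (u y : A) := KState y 1 1 1 1 1 u (y + 1) (u - homog_eval n h y 1).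

Definition odd_V s := kE s * kN s + kT s * kT' s * kP s ^+ n.-1 * kE s ^+ n.-1.

(* The quotient by P of H(T+, D+) + N^n H(T, D), where T+, D+ are the next T, D:
   modulo P both D+ and D vanish, T+ = - N T, and n is odd. *)
Definition odd_K s :=
  \sum_(j < n) h j * kN s ^+ (n - j) * kE s * kD s ^+ (n - j).-1
     * (nextT s ^+ j + (kN s * kT s) ^+ j)
  - h n * odd_V s * \sum_(i < n) nextT s ^+ (n.-1 - i) * (- (kN s * kT s)) ^+ i.

Definition odd_step s :=
  KState (nextT s) (kT s) (nextD s) (kP s) (kN s * kE s)
    ((kN s * kE s) ^+ n * kP s ^+ n.-1)
    (kT s * odd_K s
     + kN s ^+ n * (kE s * homog_eval n h (kT s) (kD s) + kX s * kW s))
    (nextW s) (kN s ^+ n * kW s).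

Record kinv s : Prop := KInv {
  kinvW : kT s + kD s = kT' s * kW s;
  kinvM : kM s * kE s = kD s ^+ n }.

(** The relation between consecutive states before the division by the new E. Both parities satisfy
    it, so the arguments at regular points and at the infinite point of a line are made once, for
    [knext]. *)
Record knext s s' : Prop := KNext {
  knextD : kD s' = kD s * kN s;
  knextT' : kT' s' = kT s;
  knextW : kW s' = - (kN s + kT' s * kM s);
  knextT : kT s' = kT s * kW s' - kD s';
  knextN : kN s' * kE s' =
    kT s * homog_eval n h (kT s') (kD s') + kN s ^+ n.+1 * kE s * kW s }.

Record odd_inv s : Prop := OddInv {
  odd_invD : kD s = kE s * kP s;
  odd_invM : kM s = kP s ^+ n * kE s ^+ n.-1;
  odd_invN : kN s * kE s = kT' s * homog_eval n h (kT s) (kD s) + kP s * kX s }.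

Lemma even_init_inv u y : kinv (even_init u y).
Proof. by split; rewrite /= ?mul1r ?mulr1 ?expr1n. Qed.

Lemma odd_init_inv u y : kinv (odd_init u y) /\ odd_inv (odd_init u y).
Proof.
split; split; rewrite /= ?mul1r ?mulr1 ?expr1n ?mul1r //.
by rewrite addrC subrK.
Qed.

Lemma even_step_inv s : kinv (even_step s).
Proof. by split; rewrite /= ?mulr1 // /nextT subrK. Qed.

Lemma even_step_next s : kE s = 1 -> knext s (even_step s).
Proof. by move=> e1; split; rewrite /= ?e1 ?mulr1. Qed.

Hypothesis n_odd : odd n.

Let n_gt0 : (0 < n)%N. Proof. by case: n n_odd. Qed.

Lemma odd_nextT s : kinv s -> odd_inv s ->
  nextT s = - (kN s * kT s + kP s * odd_V s).
Proof.
move=> [hW _] [hD hM _]; rewrite /nextT /nextW /nextD /odd_V hM hD.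
by rewrite -[X in _ ^+ X](prednK n_gt0) !exprS; ring.
Qed.

Lemma odd_KE s : kinv s -> odd_inv s ->
  kP s * odd_K s =
    homog_eval n h (nextT s) (nextD s) + kN s ^+ n * homog_eval n h (kT s) (kD s).
Proof.
move=> hi ho; rewrite /homog_eval !big_ord_recr /= !subnn !expr0 !mulr1.
rewrite /odd_K mulrBr [X in _ = _ + X]mulrDr [RHS]addrACA; congr (_ + _).
  rewrite mulr_sumr mulr_sumr -big_split /=; apply: eq_bigr => j _.
  have jn : (0 < n - j)%N by rewrite subn_gt0.
  have -> : kN s ^+ n = kN s ^+ (n - j) * kN s ^+ j.
    by rewrite -exprD subnK // ltnW.
  rewrite /nextD !exprMn -(prednK jn) /= !exprS.
  by set Dp := kD s ^+ _; rewrite (odd_invD ho); ring.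
(* As n is odd, T+^n + (N T)^n is a difference of n-th powers, divisible by T+ + N T = - P V. *)
have := subrXX (nextT s) (- (kN s * kT s)) n.
have -> : (- (kN s * kT s)) ^+ n = - (kN s ^+ n * kT s ^+ n).
  by rewrite exprNn exprMn -signr_odd n_odd mulN1r.
rewrite !opprK => e.
have -> : nextT s ^+ n = nextT s ^+ n + kN s ^+ n * kT s ^+ n - kN s ^+ n * kT s ^+ n.
  by rewrite addrK.
by rewrite e; set S := \sum_(i < n) _; rewrite (odd_nextT hi ho); ring.
Qed.

(** Multiplying [odd_invN] by W and using T' W = T + D gives N^(n+1) E W = N^n ((T + D) H(T, D) + P
    X W). The part N^n T H(T, D) completes T P K, with K = [odd_K], and the rest is divisible by P
    because D = E P. *)
Lemma odd_step_next s : kinv s -> odd_inv s -> knext s (odd_step s).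
Proof.
move=> hi ho; split => //=.
rewrite mulrDl mulrAC -[_ * odd_K s]mulrA odd_KE //.
have /(congr1 (fun x => x * kW s)) := odd_invN ho.
rewrite mulrDl [kT' s * _]mulrC -[_ * kT' s * _]mulrA -(kinvW hi) => e.
have := odd_invD ho => eD.
rewrite exprSr.
have -> : kN s ^+ n * kN s * kE s * kW s = kN s ^+ n * (kN s * kE s * kW s) by ring.
by rewrite e; set H := homog_eval n h (kT s) _; rewrite eD; ring.
Qed.

Lemma odd_step_inv s : kinv s -> odd_inv s ->
  kinv (odd_step s) /\ odd_inv (odd_step s).
Proof.
move=> hi ho; have hN := knextN (odd_step_next hi ho); move: hi ho => hi ho.
split; split => //=.
- by rewrite /nextT subrK.
- rewrite -mulrA -exprSr prednK // -exprMn /nextD (odd_invD ho); congr (_ ^+ _).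
  by ring.
- by rewrite /nextD (odd_invD ho); ring.
by rewrite [LHS]hN /=; congr (_ + _); rewrite exprS; ring.
Qed.

End Recursion.

(** Commutation with evaluation at a point turns the absence of common zeros on a line into a
    statement about orbits of states over a field. *)
Lemma kstate_map_even_step (A B : comNzRingType) (f : {rmorphism A -> B}) n h s :
  kstate_map f (even_step n h s) = even_step n (f \o h) (kstate_map f s).
Proof.
rewrite /even_step /kstate_map /nextT /nextW /nextD /=.
by rewrite !(rmorph1, rmorph0, rmorphXn, rmorphD, rmorphM, rmorphN, homog_eval_rmorph).
Qed.

Lemma kstate_map_odd_step (A B : comNzRingType) (f : {rmorphism A -> B}) n h s :
  kstate_map f (odd_step n h s) = odd_step n (f \o h) (kstate_map f s).
Proof.
rewrite /odd_step /kstate_map /odd_K /odd_V /nextT /nextW /nextD /=.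
rewrite !(rmorph1, rmorph0, rmorphXn, rmorphD, rmorphM, rmorphN, homog_eval_rmorph, rmorph_sum) /=.
congr (KState _ _ _ _ _ _ (_ * (_ - _ * _) + _) _ _).
- apply: eq_bigr => j _.
  by rewrite !(rmorphXn, rmorphD, rmorphM, rmorphN).
- by apply: eq_bigr => j _; rewrite !(rmorphXn, rmorphD, rmorphM, rmorphN).
Qed.

(** * No common zeros of T and D *)

Section Pointwise.

Variables (k : fieldType) (n : nat) (h : nat -> k).
Implicit Type s : kstate k.

(* The values of u on the successive visits of an orbit to the line y = 0: the
   curve uy + u + y = 0 is contracted to (H(0) - 1, 0), and k^2 acts on the line
   y = 0 as the translation of u by H(0) + 1. *)
Definition zorbit (j : nat) : k := h 0%N - 1 + (h 0%N + 1) *+ j.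

Definition at_generic s := [/\ kT s != 0, kT' s != 0 & kD s != 0].

Definition at_zero j s :=
  [/\ kT s = 0, kT' s != 0, kD s != 0 & kN s = zorbit j * kM s * kT' s].

(* u = infinity and y = -1, which k exchanges with the line y = 0. *)
Definition at_fibre j s :=
  [/\ kT' s = 0, kD s != 0, kN s != 0 & kN s * kW s = (zorbit j + 1) * kM s * kT s].

Definition regular s :=
  [\/ at_generic s, exists j, at_zero j s | exists j, at_fibre j s].

Hypothesis zorbit_neq0 : forall j, zorbit j != 0.

(** A generic point stays generic or, on the curve uy + u + y = 0, falls on the line y = 0; from
    there it goes to the fibre u = infinity, y = -1 and back, since [zorbit_neq0] keeps it off u =
    0. The only exit is u = 0 at a generic point, after which y is infinite. *)
Lemma regular_next s s' : kinv n s -> kinv n s' -> knext n h s s' -> regular s ->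
  regular s' \/ at_generic s /\ kN s = 0.
Proof.
move=> [hW hM] [hW' hM'] [eD eT' eW eT eN] hs.
have E0 : kD s != 0 -> kE s != 0.
  move=> d0; apply: contraTneq (expf_neq0 n d0) => e0.
  by rewrite -hM e0 mulr0 eqxx.
have M0 : kD s != 0 -> kM s != 0.
  move=> d0; apply: contraTneq (expf_neq0 n d0) => e0.
  by rewrite -hM e0 mul0r eqxx.
have E'0 : kD s' != 0 -> kE s' != 0.
  move=> d0; apply: contraTneq (expf_neq0 n d0) => e0.
  by rewrite -hM' e0 mulr0 eqxx.
case: hs => [[t0 t'0 d0] | [j [t0 t'0 d0 Nz]] | [j [t'0 d0 N0 Nz]]].
- have [N0|N0] := eqVneq (kN s) 0; first by right.
  left; have d'0 : kD s' != 0 by rewrite eD mulf_neq0.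
  have [t1|t1] := eqVneq (kT s') 0; last by apply: Or31; rewrite /at_generic eT'.
  apply: Or32; exists 0%N; split; rewrite ?eT' //.
  apply: (mulIf (E'0 d'0)); rewrite eN t1 homog_eval0x.
  (* T+ = 0 means u (1 + 1/y) = -1, which leaves u' = H(0) - 1, the starting value of [zorbit]. *)
  have NW : kN s * kW s = - kT s * kM s.
    apply: (mulIf t'0); rewrite -mulrA [kW s * _]mulrC -hW.
    have : kT s' = - (kN s * (kT s + kD s) + kT s * kT' s * kM s).
      by rewrite eT eD eW; ring.
    rewrite t1 => /eqP; rewrite eq_sym oppr_eq0 addr_eq0 => /eqP ->; ring.
  rewrite exprSr; have -> : kN s ^+ n * kN s * kE s * kW s =
     kN s ^+ n * kE s * (kN s * kW s) by ring.
  rewrite NW; have -> : (zorbit 0) * kM s' * kT s * kE s' =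
     zorbit 0 * kT s * (kM s' * kE s') by ring.
  rewrite hM' eD exprMn -hM /zorbit; ring.
- left; apply: Or33; exists j.
  have N0 : kN s != 0 by rewrite Nz !mulf_neq0 ?M0.
  have d'0 : kD s' != 0 by rewrite eD mulf_neq0.
  have W0 : kW s != 0.
    apply: contra_neq d0 => w0; move: hW; rewrite t0 w0 add0r mulr0; exact.
  have N'0 : kN s' != 0.
    have : kN s' * kE s' != 0.
      by rewrite eN t0 mul0r add0r !mulf_neq0 ?expf_neq0 ?E0.
    by rewrite mulf_eq0 negb_or => /andP[].
  split=> //; first by rewrite eT'.
  apply: (mulIf (E'0 d'0)).
  rewrite mulrAC eN t0 mul0r add0r eT t0 mul0r add0r.
  have -> : (zorbit j + 1) * kM s' * - kD s' * kE s' =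
    - (zorbit j + 1) * kD s' * (kM s' * kE s') by ring.
  have -> : kW s' = - (zorbit j + 1) * kM s * kT' s by rewrite eW Nz; ring.
  move: hW; rewrite t0 add0r => hW.
  by rewrite hM' eD exprMn -hM exprS hW; ring.
(* On the fibre u (1 + 1/y) has the finite value [zorbit j + 1], to which H(0) is added. *)
left; apply: Or32; exists j.+1.
move: hW; rewrite t'0 mul0r => hW.
have tE : kT s = - kD s by apply/eqP; rewrite -addr_eq0 hW.
have d'0 : kD s' != 0 by rewrite eD mulf_neq0.
have t1 : kT s' = 0 by rewrite eT eD eW t'0 tE; ring.
split=> //; first by rewrite eT' tE oppr_eq0.
apply: (mulIf (E'0 d'0)); rewrite eN t1 homog_eval0x.
rewrite exprSr; have -> : kN s ^+ n * kN s * kE s * kW s =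
  kN s ^+ n * kE s * (kN s * kW s) by ring.
rewrite Nz; have -> : (zorbit j.+1) * kM s' * kT' s' * kE s' =
  zorbit j.+1 * kT' s' * (kM s' * kE s') by ring.
by rewrite hM' eT' eD exprMn -hM /zorbit mulrSr; ring.
Qed.

Lemma regular_TD s : regular s -> (kT s != 0) || (kD s != 0).
Proof. by move=> [[-> //]|[j [_ _ ->]]|[j [_ ->]]]; rewrite orbT. Qed.

Section Chain.

Variables (s : nat -> kstate k) (chain : kstate k -> Prop).
Hypothesis s_inv : forall m, kinv n (s m).
Hypothesis s_next : forall m, knext n h (s m) (s m.+1).
Hypothesis chain_T : forall m, chain (s m) -> kT (s m) != 0.
Hypothesis chain_start : forall m, at_generic (s m) -> kN (s m) = 0 -> chain (s m.+1).
Hypothesis chain_next : forall m, chain (s m) -> chain (s m.+1).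

(** D is nonzero at regular points. An orbit that leaves them is caught by [chain], which is
    absorbing and forces T to be nonzero; the different cases of n differ only in the choice of
    [chain]. *)
Lemma orbit_TD m : regular (s 0%N) -> (kT (s m) != 0) || (kD (s m) != 0).
Proof.
move=> s0; suff : regular (s m) \/ chain (s m).
  by move=> [/regular_TD//|/chain_T ->].
elim: m => [|m [IH|/chain_next]]; [by left | | by right].
have [|[g N0]] := regular_next (s_inv m) (s_inv m.+1) (s_next m) IH; first by left.
by right; apply: chain_start.
Qed.

End Chain.

Lemma even_orbit_TD (s0 : kstate k) m : ~~ odd n -> (0 < n)%N ->
  [pchar k] =i pred0 -> h n != 0 -> kinv n s0 -> kE s0 = 1 -> regular s0 ->
  let s := iter m (even_step n h) s0 in (kT s != 0) || (kD s != 0).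
Proof.
move=> n_even n0 chk hn i0 e0 r0.
have i_ m' : kinv n (iter m' (even_step n h) s0).
  by case: m' => [//|m'] /=; apply: even_step_inv.
have e_ m' : kE (iter m' (even_step n h) s0) = 1 by case: m'.
have next_ m' := even_step_next n h (e_ m').
(* At y = infinity the leading coefficient u / y^n grows by h_n at each step. *)
pose chain s := [/\ kD s = 0, kT s != 0, kT' s != 0, kM s = 0 &
   exists j, kN s = h n *+ j.+1 * kT s ^+ n * kT' s].
have X0 : (0 : k) ^+ n = 0 by rewrite expr0n eqn0Ngt n0.
apply: (orbit_TD (s := fun m => iter m (even_step n h) s0) (chain := chain)) => //.
- by move=> m' [].
- move=> m' [t0 t'0 d0] N0; set s := iter m' _ _ in t0 t'0 d0 N0 *.
  have [eD eT' eW eT eN] := next_ m'; rewrite -/s in eD eT' eW eT eN.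
  have M0 : kM s != 0.
    have [_] := i_ m'; rewrite -/s => hM; apply: contraTneq (expf_neq0 n d0) => e.
    by rewrite -hM e mul0r eqxx.
  have eD0 : kD (even_step n h s) = 0 by rewrite eD N0 mulr0.
  split=> //=.
  + rewrite -[nextT s]/(kT (even_step n h s)) eT eD0 subr0 eW N0 add0r mulf_neq0 //.
    by rewrite oppr_eq0 mulf_neq0.
  + by rewrite -[nextD s]/(kD (even_step n h s)) eD0.
  exists 0%N; rewrite -[nextD s]/(kD (even_step n h s)) eD0 homog_evalx0 N0.
  by rewrite exprS !mul0r addr0 mulr1n; ring.
move=> m' [d0 t0 t'0 M0 [j Nj]]; set s := iter m' _ _ in d0 t0 t'0 M0 Nj *.
have hj : h n *+ j.+1 != 0.
  by rewrite -mulr_natr mulf_neq0 // (pcharf0P k).1.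
have N0 : kN s != 0 by rewrite Nj !mulf_neq0 ?expf_neq0.
have [eD eT' eW eT eN] := next_ m'; rewrite -/s in eD eT' eW eT eN.
have eD0 : kD (even_step n h s) = 0 by rewrite eD d0 mul0r.
have eT1 : kT (even_step n h s) = - (kT s * kN s).
  by rewrite eT eD0 eW M0; ring.
split=> //=.
- by rewrite -[nextT s]/(kT (even_step n h s)) eT1 oppr_eq0 mulf_neq0.
- by rewrite -[nextD s]/(kD (even_step n h s)) eD0.
exists j.+1; rewrite -[nextD s]/(kD (even_step n h s)) eD0 homog_evalx0.
rewrite -[nextT s]/(kT (even_step n h s)) eT1.
have [hW _] := i_ m'; rewrite -/s in hW.
rewrite exprSr; have -> : kN s ^+ n * kN s * kW s =
  kN s ^+ n * (h n *+ j.+1 * kT s ^+ n) * (kT' s * kW s) by rewrite {2}Nj; ring.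
rewrite -hW d0 addr0 exprNn -signr_odd (negbTE n_even) expr0 mul1r.
by rewrite exprMn [h n *+ j.+2]mulrSr; ring.
Qed.

(** With u finite, y' = - y (1 + 1/u) - 1 is indeterminate at y = infinity, u = -1; [hj1] keeps the
    values u = h_0 (j + 1) away from that point. *)
Lemma const_orbit_TD (s0 : kstate k) m : n = 0%N ->
  (forall j, h 0%N *+ j.+1 != 0) -> (forall j, h 0%N *+ j + 1 != 0) ->
  kinv n s0 -> kE s0 = 1 -> regular s0 ->
  let s := iter m (even_step n h) s0 in (kT s != 0) || (kD s != 0).
Proof.
move=> n0 hj0 hj1 i0 e0 r0.
have i_ m' : kinv n (iter m' (even_step n h) s0).
  by case: m' => [//|m'] /=; apply: even_step_inv.
have e_ m' : kE (iter m' (even_step n h) s0) = 1 by case: m'.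
have next_ m' := even_step_next n h (e_ m').
have M1 m' : kM (iter m' (even_step n h) s0) = 1.
  by have [_] := i_ m'; rewrite e_ mulr1 n0 expr0.
have H1 t d : homog_eval n h t d = h 0%N.
  by rewrite /homog_eval n0 big_ord1 /= subnn !expr0 !mulr1.
(* For n = 0 and y = infinity, u is finite and grows by h_0 at each step. *)
pose chain s := [/\ kD s = 0, kT s != 0, kT' s != 0 &
   exists j, kN s = h 0%N *+ j.+1 * kT' s].
apply: (orbit_TD (s := fun m => iter m (even_step n h) s0) (chain := chain)) => //.
- by move=> m' [].
- move=> m' [t0 t'0 d0] N0; set s := iter m' _ _ in t0 t'0 d0 N0 *.
  have [eD eT' eW eT eN] := next_ m'; rewrite -/s in eD eT' eW eT eN.
  have eD0 : kD (even_step n h s) = 0 by rewrite eD N0 mulr0.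
  split=> //=.
  + rewrite -[nextT s]/(kT (even_step n h s)) eT eD0 subr0 eW N0 add0r mulf_neq0 //.
    by rewrite oppr_eq0 mulf_neq0 // M1 oner_eq0.
  by exists 0%N; rewrite H1 N0 exprS !mul0r addr0 mulrC.
move=> m' [d0 t0 t'0 [j Nj]]; set s := iter m' _ _ in d0 t0 t'0 Nj *.
have [eD eT' eW eT eN] := next_ m'; rewrite -/s in eD eT' eW eT eN.
have eD0 : kD (even_step n h s) = 0 by rewrite eD d0 mul0r.
have [hW _] := i_ m'; rewrite -/s d0 addr0 in hW.
split=> //=.
  rewrite -[nextT s]/(kT (even_step n h s)) eT eD0 eW M1 Nj subr0 mulf_neq0 //.
  have -> : - (h 0%N *+ j.+1 * kT' s + kT' s * 1) = - (kT' s * (h 0%N *+ j.+1 + 1)) by ring.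
  by rewrite oppr_eq0 mulf_neq0.
have N1 : kN s ^+ n.+1 = kN s by rewrite n0 expr1.
exists j.+1; rewrite H1 N1 Nj -mulrA -hW [h 0%N *+ j.+2]mulrSr; ring.
Qed.

(* At y = infinity and for n odd, u / y^n alternates between h_n and 0; when it
   is 0, the coefficient u / y^(n-1) has grown by odd_kappa in two steps. *)
Definition odd_kappa : k :=
  h n.-1 *+ 2 + h n - h n *+ n - (n == 1%N)%:R.

(** This is the coefficient of y^(n-1) in u' = H(y') + u (1 + 1/y) at y = infinity, for u close to
    H(y). H(y') + H(y) gives 2 h_(n-1) and, as y' = - y - 1 - y/u, also - n h_n; the term u / y
    gives h_n. Only for n = 1 does y/u, about 1 / h_n, have an effect, namely the final -1. *)
Lemma odd_step_chainN s : odd n -> kinv n s -> odd_inv n h s -> kP s = 0 ->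
  kN (odd_step n h s) = kN s ^+ n * (odd_kappa * kE s * kT s ^+ n + kX s * kW s).
Proof.
move=> n_odd hi ho P0; have n0 : (0 < n)%N by case: n n_odd.
have d0 : kD s = 0 by rewrite (odd_invD ho) P0 mulr0.
have t1 : nextT s = - (kN s * kT s) by rewrite (odd_nextT n_odd hi ho) P0; ring.
have NE : kN s * kE s = kT' s * (h n * kT s ^+ n).
  by rewrite (odd_invN ho) P0 mul0r addr0 d0 homog_evalx0.
rewrite /= /odd_K d0 homog_evalx0 t1.
have even1 : ~~ odd n.-1 by rewrite -oddS prednK.
have sgn (x : k) : (- x) ^+ n.-1 = x ^+ n.-1.
  by rewrite exprNn -signr_odd (negbTE even1) expr0 mul1r.
have -> : \sum_(i < n) (- (kN s * kT s)) ^+ (n.-1 - i) * (- (kN s * kT s)) ^+ i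
   = (kN s * kT s) ^+ n.-1 *+ n.
  rewrite (eq_bigr (fun=> (kN s * kT s) ^+ n.-1)) ?sumr_const ?card_ord // => i _.
  by rewrite -exprD subnK ?sgn // -ltnS prednK.
have -> : \sum_(j < n) h j * kN s ^+ (n - j) * kE s * 0 ^+ (n - j).-1
     * ((- (kN s * kT s)) ^+ j + (kN s * kT s) ^+ j) =
   h n.-1 * kN s * kE s * ((kN s * kT s) ^+ n.-1 *+ 2).
  have n1n : (n.-1 < n)%N by rewrite prednK.
  rewrite (bigD1 (Ordinal n1n)) //= big1 ?addr0 => [|i].
    have -> : (n - n.-1)%N = 1%N by lia.
    by rewrite expr0 expr1 mulr1 sgn mulr2n.
  rewrite -val_eqE /= => i1; have i_lt := ltn_ord i.
  have -> : (0 : k) ^+ (n - i).-1 = 0.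
    by rewrite expr0n; case: eqP => // e; exfalso; lia.
  by rewrite mulr0 mul0r.
have expn x : x ^+ n = x * x ^+ n.-1 :> k by rewrite -exprS prednK.
rewrite /odd_V P0 /odd_kappa.
(* For n = 1 the factor P^(n-1) in [odd_V] is 1 and survives at P = 0. *)
have [n1|n1] := eqVneq n 1%N.
  move: NE; rewrite n1 /= !expr0 !expr1 !mulr1 => NE.
  have -> : h 1%N * (kE s * kN s + kT s * kT' s)= h 1%N * kE s * kN s + kN s * kE s.
    by rewrite NE; ring.
  by ring.
rewrite expr0n; have -> : n.-1 == 0%N = false by lia.
by rewrite mulr0 mul0r addr0 subr0 !expn !exprMn; ring.
Qed.

Lemma odd_orbit_TD (s0 : kstate k) m : odd n -> h n != 0 ->
  (forall j, odd_kappa *+ j.+1 != 0) ->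
  (n = 1%N -> forall j, odd_kappa *+ j + 1 != 0) ->
  kinv n s0 -> odd_inv n h s0 -> regular s0 ->
  let s := iter m (odd_step n h) s0 in (kT s != 0) || (kD s != 0).
Proof.
move=> n_odd hn kap0 kap1 i0 o0 r0; have n0 : (0 < n)%N by case: n n_odd.
have io_ m' : kinv n (iter m' (odd_step n h) s0) /\ odd_inv n h (iter m' (odd_step n h) s0).
  by elim: m' => [//|m' [IH1 IH2]] /=; apply: odd_step_inv.
have expn x : x ^+ n = x * x ^+ n.-1 :> k by rewrite -exprS prednK.
have next_ m' : knext n h (iter m' (odd_step n h) s0) (iter m'.+1 (odd_step n h) s0).
  by have [i1 i2] := io_ m'; apply: odd_step_next.
(* In terms of u and y at y = infinity: (u - H(y)) / y^(n-1) equals j times [odd_kappa] in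
   [chain_odd], and u / y^(n-1) equals j + 1 times [odd_kappa] in [chain_even]. *)
pose chain_odd s := [/\ kP s = 0, kE s != 0 &
   exists j, kX s * kW s = odd_kappa *+ j * kE s * kT s ^+ n].
pose chain_even s := [/\ kE s = 0, kP s != 0 &
   exists j, kN s = odd_kappa *+ j.+1 * kP s * kT' s * kT s ^+ n.-1].
pose chain s := [/\ kT s != 0, kT' s != 0 & chain_odd s \/ chain_even s].
have X0 : (0 : k) ^+ n = 0 by rewrite expr0n eqn0Ngt n0.
apply: (orbit_TD (s := fun m => iter m (odd_step n h) s0) (chain := chain)) => //.
- by move=> m'; have [] := io_ m'.
- by move=> m' [].
- move=> m' [t0 t'0 d0] N0; have := next_ m'; have := io_ m'; rewrite /=.
  set s := iter m' _ _ in t0 t'0 d0 N0 *; move=> [[hW hM] [oD oM oN]] [eD eT' eW eT eN].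
  have M0 : kM s != 0.
    by apply: contraTneq (expf_neq0 n d0) => e; rewrite -hM e mul0r eqxx.
  have P0 : kP s != 0.
    by apply: contraTneq d0 => e; rewrite oD e mulr0 eqxx.
  split; first 2 last.
  + left; split; rewrite /= ?N0 ?mul0r //; exists 0%N.
    by rewrite X0 ?mulr0n !mul0r.
  + rewrite eT eD N0 mulr0 subr0 eW N0 add0r mulf_neq0 //.
    by rewrite oppr_eq0 mulf_neq0.
  by rewrite eT'.
move=> m' [t0 t'0 ch]; have := next_ m'; have := io_ m'; rewrite /=.
set s := iter m' _ _ in t0 t'0 ch *; move=> [hi ho] [eD eT' eW eT eN].
have d0 : kD s = 0.
  by rewrite (odd_invD ho); case: ch => [[-> _ _]|[-> _ _]]; rewrite ?mulr0 ?mul0r.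
have hW : kT' s * kW s = kT s by rewrite -(kinvW hi) d0 addr0.
case: ch => [[P0 E0 [j Xj]]|[E0 P0 [j Nj]]].
- have N0 : kN s != 0.
    have := odd_invN ho; rewrite P0 mul0r addr0 d0 homog_evalx0 => NE.
    have : kN s * kE s != 0 by rewrite NE !mulf_neq0 ?expf_neq0.
    by rewrite mulf_eq0 negb_or => /andP[].
  have t1 : kT (odd_step n h s) = - (kN s * kT s).
    by rewrite /= (odd_nextT n_odd hi ho) P0; ring.
  split; [by rewrite t1 oppr_eq0 mulf_neq0 | by rewrite eT' | right].
  split; [by rewrite /= P0 | by rewrite /= mulf_neq0 | exists j].
  rewrite (odd_step_chainN n_odd hi ho P0) Xj t1 /=.
  have even1 : ~~ odd n.-1 by rewrite -oddS prednK.
  rewrite exprNn -signr_odd (negbTE even1) expr0 mul1r mulrSr.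
  by rewrite !expn !exprMn; ring.
have t1 : kT (odd_step n h s) = - (kT s * (kN s + kT' s * kM s)).
  by rewrite eT eD d0 mul0r subr0 eW; ring.
have N0 : kN s != 0 by rewrite Nj !mulf_neq0 ?expf_neq0.
have [t10 Nt] : kT (odd_step n h s) != 0 /\
    kN s ^+ n = odd_kappa *+ j.+1 * kP s * kT' s * kT (odd_step n h s) ^+ n.-1.
  (* For n = 1 the value of u in [chain_even] is finite, and u = -1 has to be excluded as for
     constant F. *)
  have [n1|n1] := eqVneq n 1%N.
    move: Nj t1; rewrite (odd_invM ho) n1 /= !expr0 !expr1 !mulr1 => Nj ->.
    split; last exact: Nj.
    rewrite Nj oppr_eq0 mulf_neq0 //.
    have -> : odd_kappa *+ j.+1 * kP s * kT' s + kT' s * kP s =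
      kP s * kT' s * (odd_kappa *+ j.+1 + 1) by ring.
    by rewrite !mulf_neq0 ?kap1.
  have M0 : kM s = 0.
    rewrite (odd_invM ho) E0 expr0n; have -> : n.-1 == 0%N = false by lia.
    by rewrite mulr0.
  have {}t1 : kT (odd_step n h s) = - (kT s * kN s) by rewrite t1 M0; ring.
  rewrite t1; split; first by rewrite oppr_eq0 mulf_neq0.
  have even1 : ~~ odd n.-1 by rewrite -oddS prednK.
  rewrite exprNn -signr_odd (negbTE even1) expr0 mul1r.
  by rewrite expn {1}Nj exprMn; ring.
split=> //; left; split; [by rewrite /= E0 mulr0 | by [] | exists j.+1].
(* With D = 0 the relation T + D = T' W telescopes over two consecutive states. *)
have WW : kW s * kW (odd_step n h s) = kT (odd_step n h s) / kT' s.
  apply: (mulIf t'0); rewrite mulfVK // mulrAC [kW s * _]mulrC hW.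
  by rewrite eT eD d0 mul0r subr0.
have -> : kX (odd_step n h s) * kW (odd_step n h s) = kN s ^+ n * (kT (odd_step n h s) / kT' s).
  by rewrite -WW mulrA.
have -> : kE (odd_step n h s) = kP s by [].
by rewrite Nt [in RHS]expn; field.
Qed.

End Pointwise.

(** * Degrees along a line *)

Section Infinity.

Variables (k : fieldType) (n : nat) (c : nat -> k).
Local Notation h := (fun j => (c j)%:P).
Implicit Types (p q : {poly k}) (s : kstate {poly k}).

Definition pdeg p := (size p).-1.

Lemma pdegM p q : p != 0 -> q != 0 -> pdeg (p * q) = (pdeg p + pdeg q)%N.
Proof.
move=> p0 q0; rewrite /pdeg size_mul //; move: p0 q0; rewrite -!size_poly_gt0.
by case: (size p) => [//|a _]; case: (size q) => [//|b _]; rewrite addSn addnS.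
Qed.

Lemma pdegX p m : p != 0 -> pdeg (p ^+ m) = (m * pdeg p)%N.
Proof.
move=> p0; elim: m => [|m IH]; first by rewrite expr0 /pdeg size_poly1.
by rewrite exprS pdegM ?expf_neq0 // IH.
Qed.

Lemma size_homog_eval (t d : {poly k}) : d != 0 -> (size t <= size d)%N ->
  (size (homog_eval n h t d) <= size (d ^+ n))%N.
Proof.
move=> d0 td; apply: (leq_trans (size_sum _ _ _)); apply/bigmax_leqP => j _.
have [->|cj] := eqVneq (c j) 0; first by rewrite !mul0r size_poly0.
rewrite -mulrA size_Cmul //.
have [->|t0] := eqVneq (t ^+ j) 0; first by rewrite mul0r size_poly0.
have [t00|t00] := eqVneq t 0.
  move: t0; rewrite t00 expr0n; case: (nat_of_ord j) => [_|? /eqP//].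
  by rewrite mul1r subn0.
have s0 p : p != 0 -> size p = (pdeg p).+1 by move=> p0; rewrite /pdeg -polySpred.
move: td; rewrite !s0 ?mulf_neq0 ?expf_neq0 // pdegM ?expf_neq0 // !pdegX // !ltnS => td.
have -> : (n * pdeg d = j * pdeg d + (n - j) * pdeg d)%N.
  by rewrite -mulnDl subnKC // -ltnS.
by rewrite leq_add2r leq_mul2l td orbT.
Qed.

(** Letters stand for degrees. Since T and D have equal degree, N^(n+1) E W has degree one more than
    T D+^n, hence it dominates the other summand of [knextN]. *)
Lemma infinity_count m N E M T' D W : N = (M + T').+1%N -> (M + E = m * D)%N ->
  (W + T' = D)%N -> (m.+1 * N + E + W = (D + m * (D + N)).+1)%N.
Proof. by rewrite mulSn mulnDr; lia. Qed.

(* Along the line y = theta the point at infinity is a simple pole of u, and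
   T/D takes the value theta there. *)
Definition at_infinity theta s :=
  [/\ kD s != 0, kT' s != 0, (theta != 0) && (theta + 1 != 0),
      (size (kT s - theta%:P * kD s)%R < size (kD s))%N
    & size (kN s) = (size (kM s * kT' s)%R).+1].

Lemma at_infinity_start theta s : (theta != 0) && (theta + 1 != 0) ->
  kT s = theta%:P -> kT' s = 1 -> kD s = 1 -> kM s = 1 -> kN s = 'X - 1 ->
  at_infinity theta s.
Proof.
move=> th hT hT' hD hM hN; split; rewrite ?hT ?hT' ?hD ?hM ?hN ?oner_neq0 //.
  by rewrite mulr1 subrr size_poly0 size_poly1.
by rewrite mulr1 size_poly1 -polyC1 size_XsubC.
Qed.

Lemma at_infinity_T theta s : at_infinity theta s -> size (kT s) = size (kD s).
Proof.
move=> [d0 _ /andP[th _] sz _]; rewrite -(subrK (theta%:P * kD s) (kT s)).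
by rewrite addrC size_polyDl size_Cmul.
Qed.

Lemma at_infinity_neq0 theta s : kinv n s -> at_infinity theta s ->
  [/\ kT s != 0, kE s != 0, kM s != 0 & kN s != 0].
Proof.
move=> [_ hM] hs; have sT := at_infinity_T hs; have [d0 t'0 _ _ sN] := hs.
have := expf_neq0 n d0; rewrite -hM mulf_eq0 negb_or => /andP[-> ->]; split=> //.
  by rewrite -size_poly_gt0 sT size_poly_gt0.
by rewrite -size_poly_gt0 sN.
Qed.

(** At a pole of u one has y' = - y - 1 and u' close to u (1 + 1/y). The pole stays simple because
    theta is neither 0 nor -1, a condition stable under the passage to -1 - theta. *)
Lemma at_infinity_next theta s s' : kinv n s -> kinv n s' -> knext n h s s' ->
  at_infinity theta s -> at_infinity (- 1 - theta) s'.
Proof.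
move=> hi [_ hM'] [eD eT' eW eT eN] hs.
have [T0 E0 M0 N0] := at_infinity_neq0 hi hs.
have sT := at_infinity_T hs.
have [D0 T'0 /andP[th0 th1] sTD sN] := hs.
have [hW hM] := hi.
have D'0 : kD s' != 0 by rewrite eD mulf_neq0.
have := expf_neq0 n D'0; rewrite -hM' mulf_eq0 negb_or => /andP[M'0 E'0].
have s0 p : p != 0 -> size p = (pdeg p).+1 by move=> p0; rewrite /pdeg -polySpred.
have th' : (- 1 - theta != 0) && (- 1 - theta + 1 != 0).
  by rewrite addrAC addNr add0r oppr_eq0 th0 -opprD oppr_eq0 addrC th1.
have sTD' : (size (kT s' - (- 1 - theta)%:P * kD s')%R < size (kD s'))%N.
  rewrite eT eW eD.
  have -> : kT s * - (kN s + kT' s * kM s) - kD s * kN s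
      - (- 1 - theta)%:P * (kD s * kN s) =
    - ((kT s - theta%:P * kD s) * kN s + kT s * (kM s * kT' s)).
    by rewrite !(polyCB, polyCN); ring.
  rewrite size_polyN; apply: (leq_ltn_trans (size_polyD _ _)); rewrite gtn_max.
  have dN : pdeg (kN s) = (pdeg (kM s * kT' s)).+1.
    by move: sN; rewrite !s0 ?mulf_neq0 // => -[].
  apply/andP; split.
    have [->|r0] := eqVneq (kT s - theta%:P * kD s) 0.
      by rewrite mul0r size_poly0 size_poly_gt0 mulf_neq0.
    move: sTD; rewrite !s0 ?mulf_neq0 // !ltnS => sTD.
    by rewrite !pdegM // ltn_add2r.
  rewrite !s0 ?mulf_neq0 // ltnS !(pdegM T0, pdegM D0) ?mulf_neq0 //.
  have -> : pdeg (kT s) = pdeg (kD s) by rewrite /pdeg sT.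
  by rewrite dN ltn_add2l.
have sT's : size (kT s') = size (kD s').
  rewrite -(subrK ((- 1 - theta)%:P * kD s') (kT s')) addrC size_polyDl ?size_Cmul //;
  by case/andP: th'.
split=> //; first by rewrite eT'.
have W0 : kW s != 0 /\ (pdeg (kW s) + pdeg (kT' s) = pdeg (kD s))%N.
  have : size (kT' s * kW s) = size (kD s).
    rewrite -hW; have -> : kT s + kD s = (theta + 1)%:P * kD s + (kT s - theta%:P * kD s).
      by rewrite polyCD; ring.
    by rewrite size_polyDl size_Cmul.
  have [->|w0] := eqVneq (kW s) 0.
    by rewrite mulr0 size_poly0 => /esym/eqP; rewrite size_poly_eq0 (negbTE D0).
  by rewrite !s0 ?mulf_neq0 // pdegM // => -[<-]; rewrite addnC.
have [w0 dW] := W0.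
have dN : pdeg (kN s) = (pdeg (kM s) + pdeg (kT' s)).+1.
  by move: sN; rewrite !s0 ?mulf_neq0 // pdegM // => -[].
have dT : pdeg (kT s) = pdeg (kD s) by rewrite /pdeg sT.
have dM : (pdeg (kM s) + pdeg (kE s) = n * pdeg (kD s))%N.
  by rewrite -pdegM // hM pdegX.
pose big := kN s ^+ n.+1 * kE s * kW s.
have big0 : big != 0 by rewrite !mulf_neq0 ?expf_neq0.
have dbig : pdeg big = (pdeg (kT s * kD s' ^+ n)).+1.
  rewrite !pdegM ?mulf_neq0 ?expf_neq0 // !pdegX // dT eD pdegM //.
  exact: (infinity_count dN dM dW).
have small : (size (kT s * homog_eval n h (kT s') (kD s'))%R < size big)%N.
  rewrite (s0 big) // dbig ltnS; apply: (leq_trans (size_polyMleq _ _)).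
  rewrite (s0 (kT s)) // addSn /= pdegM ?expf_neq0 // -addnS leq_add2l -s0 ?expf_neq0 //.
  exact: size_homog_eval D'0 (eq_leq sT's).
have sN' : size (kN s' * kE s') = size big.
  by rewrite eN addrC size_polyDl.
have N'0 : kN s' != 0.
  apply: contra_neq big0 => e; apply/eqP; rewrite -size_poly_eq0 -sN' e mul0r size_poly0.
  by [].
have dN' : pdeg (kN s') = (pdeg (kM s') + pdeg (kT s)).+1.
  apply/eqP; rewrite -(eqn_add2r (pdeg (kE s'))) -pdegM // /pdeg sN' -/(pdeg big) dbig.
  by rewrite -hM' !pdegM ?mulf_neq0 // addSn addnCA addnA.
by rewrite eT' !s0 ?mulf_neq0 // dN' pdegM.
Qed.

(** Zeros and poles of u balance on the projective line: the summand 1 is the pole at infinity, and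
    M E = D^n trades the degree of M for that of D. *)
Lemma at_infinity_pdegN theta s : kinv n s -> at_infinity theta s ->
  (pdeg (kN s) + pdeg (kE s) = n * pdeg (kD s) + pdeg (kT' s) + 1)%N.
Proof.
move=> hi hs; have [T0 E0 M0 N0] := at_infinity_neq0 hi hs; have [D0 T'0 _ _ sN] := hs.
have dN : pdeg (kN s) = (pdeg (kM s) + pdeg (kT' s)).+1.
  by rewrite -pdegM // /pdeg sN /= prednK // size_poly_gt0 mulf_neq0.
by rewrite dN addSn addn1 addnAC -pdegM // (kinvM hi) pdegX.
Qed.

Lemma at_infinity_pdegD theta s s' : kinv n s -> at_infinity theta s -> knext n h s s' ->
  pdeg (kD s') = (pdeg (kD s) + pdeg (kN s))%N /\ pdeg (kT' s') = pdeg (kD s).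
Proof.
move=> hi hs knx; have [T0 E0 M0 N0] := at_infinity_neq0 hi hs; have [D0 _ _ _ _] := hs.
by rewrite (knextD knx) (knextT' knx) pdegM // /pdeg (at_infinity_T hs).
Qed.

End Infinity.

Lemma coprimep_no_root (k : closedFieldType) (p q : {poly k}) :
  (forall x, (p.[x] != 0) || (q.[x] != 0)) -> coprimep p q.
Proof.
move=> pq; apply: Pdiv.ClosedField.root_coprimep => x /rootP px.
by have := pq x; rewrite px eqxx.
Qed.

(** * Growth of linear recurrences *)

Section Growth.

Variables (R : realType) (delta : R) (c2 c1 c0 : nat).
Hypothesis delta_gt0 : 0 < delta.
Hypothesis delta_root : delta ^+ 3 = c2%:R * delta ^+ 2 + c1%:R * delta + c0%:R.

Lemma recurrence_upper (a : nat -> nat) :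
  (forall m, a m.+3 <= c2 * a m.+2 + c1 * a m.+1 + c0 * a m)%N ->
  exists2 K : R, 0 < K & forall m, (a m)%:R <= K * delta ^+ m.
Proof.
move=> ha; pose K : R := 1 + (a 0%N)%:R + (a 1%N)%:R / delta + (a 2%N)%:R / delta ^+ 2.
have p i j : 0 <= (a i)%:R / delta ^+ j by rewrite divr_ge0 // exprn_ge0 // ltW.
have K0 : 0 < K.
  by have := p 0%N 0%N; have := p 1%N 1%N; have := p 2%N 2%N; rewrite /K expr0 expr1 divr1; lra.
exists K => // m; suff [] : [/\ (a m)%:R <= K * delta ^+ m,
  (a m.+1)%:R <= K * delta ^+ m.+1 & (a m.+2)%:R <= K * delta ^+ m.+2] by [].
elim: m => [|m [h0 h1 h2]].
  have := p 0%N 0%N; have := p 1%N 1%N; have := p 2%N 2%N.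
  rewrite /K expr0 expr1 divr1 mulr1 => p2 p1 p0; split; first by lra.
    rewrite -ler_pdivrMr //; lra.
  rewrite -ler_pdivrMr ?exprn_gt0 //; lra.
split=> //; apply: (le_trans (y := (c2 * a m.+2 + c1 * a m.+1 + c0 * a m)%:R)).
  by rewrite ler_nat.
rewrite !natrD !natrM.
have -> : K * delta ^+ m.+3 = c2%:R * (K * delta ^+ m.+2) + c1%:R * (K * delta ^+ m.+1)
   + c0%:R * (K * delta ^+ m).
  have -> : delta ^+ m.+3 = delta ^+ m * delta ^+ 3 by rewrite -exprD addn3.
  by rewrite delta_root !exprS; ring.
by rewrite !lerD // ler_wpM2l.
Qed.

Lemma recurrence_lower (a : nat -> nat) (m0 : nat) :
  (0 < a m0)%N -> (0 < a m0.+1)%N -> (0 < a m0.+2)%N ->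
  (forall m, c2 * a m.+2 + c1 * a m.+1 + c0 * a m <= a m.+3)%N ->
  exists2 K : R, 0 < K & forall m, (m0 <= m)%N -> K * delta ^+ m <= (a m)%:R.
Proof.
move=> a0 a1 a2 ha.
(* With this K the three initial values of K delta^i are at most 1, hence below the positive
   integers a_i. *)
pose K := (1 + delta ^+ m0 + delta ^+ m0.+1 + delta ^+ m0.+2)^-1.
have p i : 0 <= delta ^+ i by rewrite exprn_ge0 // ltW.
have L0 : 0 < 1 + delta ^+ m0 + delta ^+ m0.+1 + delta ^+ m0.+2.
  by have := p m0; have := p m0.+1; have := p m0.+2; lra.
have K0 : 0 < K by rewrite invr_gt0.
have Kle i b : delta ^+ i <= 1 + delta ^+ m0 + delta ^+ m0.+1 + delta ^+ m0.+2 -> (0 < b)%N ->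
    K * delta ^+ i <= b%:R :> R.
  move=> hi b0; apply: (le_trans (y := 1)); last by rewrite ler1n.
  by rewrite mulrC ler_pdivrMr // mul1r.
exists K => // m /subnKC <-; move: (m - m0)%N => {}m.
suff [] : [/\ K * delta ^+ (m0 + m) <= (a (m0 + m)%N)%:R,
  K * delta ^+ (m0 + m).+1 <= (a (m0 + m).+1)%:R
  & K * delta ^+ (m0 + m).+2 <= (a (m0 + m).+2)%:R] by [].
elim: m => [|m]; last rewrite addnS; last move: (m0 + m)%N => {}m [h0 h1 h2].
  rewrite addn0; have := p m0; have := p m0.+1; have := p m0.+2 => q2 q1 q0.
  by split; apply: Kle => //; lra.
split=> //; apply: (le_trans (y := (c2 * a m.+2 + c1 * a m.+1 + c0 * a m)%:R)); last first.
  by rewrite ler_nat.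
rewrite !natrD !natrM.
have -> : K * delta ^+ m.+3 = c2%:R * (K * delta ^+ m.+2) + c1%:R * (K * delta ^+ m.+1)
   + c0%:R * (K * delta ^+ m).
  have -> : delta ^+ m.+3 = delta ^+ m * delta ^+ 3 by rewrite -exprD addn3.
  by rewrite delta_root !exprS; ring.
by rewrite !lerD // ler_wpM2l.
Qed.

End Growth.

(** Multiplicative constants are harmless since K^(1/m) tends to 1. *)
Lemma cvg_root_growth (R : realType) (delta K1 K2 : R) (m0 : nat) (d : nat -> nat) :
  0 < delta -> 0 < K1 -> 0 < K2 ->
  (forall m, (m0 <= m)%N -> K1 * delta ^+ m <= (d m)%:R) ->
  (forall m, (d m)%:R <= K2 * delta ^+ m) ->
  (fun m => (d m)%:R `^ m%:R^-1) @ \oo --> delta.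
Proof.
move=> dl0 K10 K20 hlo hhi.
have key (K : R) : 0 < K -> (fun m => (K `^ m%:R^-1) * delta) @ \oo --> delta.
  move=> K0; rewrite -[X in _ --> X]mul1r; apply: cvgMr_tmp.
  have -> : (fun m => K `^ m%:R^-1) = (fun m : nat => expR (m%:R^-1 * ln K)).
    by apply/funext => m; rewrite /powR gt_eqF.
  rewrite -[X in _ --> X]expR0; apply: continuous_cvg; first exact: continuous_expR.
  rewrite -[X in _ --> X](mul0r (ln K)); apply: cvgMr_tmp.
  by rewrite -(cvg_shiftS (fun m : nat => m%:R^-1 : R)); exact: cvg_harmonic.
have pw (K : R) m : 0 < K -> (0 < m)%N -> (K * delta ^+ m) `^ m%:R^-1 = K `^ m%:R^-1 * delta.
  move=> K0 mp; rewrite powRM ?ltW ?exprn_gt0 //; congr (_ * _).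
  by rewrite -powR_mulrn ?ltW // -powRrM divff ?powRr1 ?ltW // pnatr_eq0 -lt0n.
apply: (squeeze_cvgr _ (key _ K10) (key _ K20)).
near=> m.
have mp : (0 < m)%N by near: m; exact: nbhs_infty_gt.
have mm : (m0 <= m)%N by near: m; exact: nbhs_infty_ge.
rewrite -!pw //; apply/andP; split; apply: ge0_ler_powR;
  rewrite ?nnegrE ?invr_ge0 ?ler0n ?mulr_ge0 ?exprn_ge0 ?(ltW K10) ?(ltW K20) ?(ltW dl0) //.
exact: hlo.
Unshelve. all: by end_near. Qed.

(** The quadratic equation is multiplied by delta so that both parities use the same third-order
    recurrence. *)
Lemma even_largest_root (R : realType) (n : nat) : exists2 delta : R, 0 < delta &
  largest_root ('X^2 - n.+1%:R *: 'X - 1) delta /\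
  delta ^+ 3 = n.+1%:R * delta ^+ 2 + 1%:R * delta + 0%:R.
Proof.
set p := _ - 1; have pE x : p.[x] = x ^+ 2 - n.+1%:R * x - 1 by rewrite /p !hornerE.
have n0 : (0 : R) <= n%:R by rewrite ler0n.
(* The polynomial is -1 at 0 and n + 1 at n + 2. *)
have [x /andP[x0 _] /rootP] : exists2 x, 0 <= x <= n.+2%:R & root p x.
  apply: poly_ivt; first by rewrite ler0n.
  rewrite !pE -[n.+2]addn2 -[n.+1]addn1 !natrD; apply/andP; split; nra.
rewrite pE => px; have {x0} x0 : 0 < x by rewrite lt_neqAle x0 andbT; apply/eqP => e; rewrite -e in px; lra.
have px' : x ^+ 2 = n.+1%:R * x + 1 by lra.
exists x => //; split; last by rewrite exprS {1}px'; ring.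
split; first by rewrite rootE pE; apply/eqP; lra.
move=> s; rewrite rootE pE => /eqP ps; rewrite leNgt; apply/negP => xs.
(* Two distinct roots have sum n + 1 and product -1, so a root other than x > 0 is negative. *)
have : (s - x) * (s + x - n.+1%:R) = 0 by lra.
move/eqP; rewrite mulf_eq0 subr_eq0 => /orP[/eqP e|/eqP e]; first by lra.
by nra.
Qed.

Lemma odd_largest_root (R : realType) (n : nat) : exists2 delta : R, 0 < delta &
  largest_root ('X^3 - n%:R *: 'X^2 - n.+1%:R *: 'X - 1) delta /\
  delta ^+ 3 = n%:R * delta ^+ 2 + n.+1%:R * delta + 1%:R.
Proof.
set p := _ - 1.
have pE x : p.[x] = x ^+ 3 - n%:R * x ^+ 2 - n.+1%:R * x - 1 by rewrite /p !hornerE.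
have n0 : (0 : R) <= n%:R by rewrite ler0n.
have [x /andP[x0 _] /rootP] : exists2 x, 0 <= x <= n.+2%:R & root p x.
  apply: poly_ivt; first by rewrite ler0n.
  rewrite !pE -[n.+2]addn2 -[n.+1]addn1 !natrD; apply/andP; split; nra.
rewrite pE => px; have {x0} x0 : 0 < x by rewrite lt_neqAle x0 andbT; apply/eqP => e; rewrite -e in px; lra.
have px' : x ^+ 3 = n%:R * x ^+ 2 + n.+1%:R * x + 1%:R by lra.
exists x => //; split => //.
split; first by rewrite rootE pE; apply/eqP; lra.
move=> s; rewrite rootE pE => /eqP ps; rewrite leNgt; apply/negP => xs.
have s0 : 0 < s by lra.
have ps' : s ^+ 3 = n%:R * s ^+ 2 + n.+1%:R * s + 1 by lra.
(* For positive arguments the equation reads 1 = n/x + (n+1)/x^2 + 1/x^3 with a decreasing right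
   side. Comparing it at x and s and clearing denominators gives this identity, whose left side is
   positive if s > x. *)
have : n%:R * (s ^+ 2 * x ^+ 2) * (s - x) + n.+1%:R * (s * x) * (s ^+ 2 - x ^+ 2)
   + (s ^+ 3 - x ^+ 3) = 0.
  have : s ^+ 3 * x ^+ 3 - x ^+ 3 * s ^+ 3 = 0 by ring.
  by rewrite {1}px' {2}ps' => e; rewrite -[RHS]e; ring.
have a1 : 0 <= n%:R * (s ^+ 2 * x ^+ 2) * (s - x).
  by apply: mulr_ge0; [apply: mulr_ge0 => //; apply: mulr_ge0; exact: sqr_ge0 | lra].
have a2 : 0 <= n.+1%:R * (s * x) * (s ^+ 2 - x ^+ 2).
  apply: mulr_ge0; first by apply: mulr_ge0 => //; apply: mulr_ge0; exact: ltW.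
  by rewrite subr_ge0; apply: lerXn2r; rewrite ?nnegrE ltW.
have a3 : 0 < s ^+ 3 - x ^+ 3 by rewrite subr_gt0 ltrXn2r // ltW.
lra.
Qed.

(** * Cancellation of factors in C[x][y] *)

Section GaussLemma.

Variable K : closedFieldType.
Local Notation B := {poly {poly K}}.
Implicit Types (p q g : B) (c : {poly K}) (a : K).

Definition linC a : B := ('X - a%:P)%:P.
Definition at_x a p : {poly K} := map_poly (horner_eval a) p.
Definition div_lin a p : B := map_poly (fun c => c %/ ('X - a%:P)) p.

Lemma at_xM a p q : at_x a (p * q) = at_x a p * at_x a q.
Proof. by rewrite /at_x rmorphM. Qed.

Lemma at_x_lin a : at_x a (linC a) = 0.
Proof. by rewrite /at_x /linC map_polyC /= /horner_eval !hornerE subrr. Qed.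

Lemma linC_neq0 a : linC a != 0.
Proof. by rewrite /linC polyC_eq0 polyXsubC_eq0. Qed.

Lemma at_x_eq0 a p : at_x a p = 0 -> p = linC a * div_lin a p.
Proof.
move=> p0; apply/polyP => i; rewrite /linC coefCM coef_map_id0 ?div0p //.
have : root p`_i a by rewrite rootE -[_.[a]]/(horner_eval a _) -coef_map -/(at_x a p) p0 coef0.
by rewrite -dvdp_XsubCl mulrC => /divpK ->.
Qed.

Lemma size_linC_mul a p : size (linC a * p) = size p.
Proof. by rewrite /linC size_Cmul // polyXsubC_eq0. Qed.

Lemma peel_content (I : finType) c (f q : I -> B) g : c != 0 ->
  (forall i, c%:P * f i = q i * g) ->
  exists (q' : I -> B) (g' : B), (forall i, f i = q' i * g') /\ size g' = size g.
Proof.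
elim: {c}(size c) {-2}c (leqnn (size c)) f q g => [|N IH] c.
  by rewrite leqn0 size_poly_eq0 => /eqP-> f q g /eqP.
move=> szc f q g c0 fE; have [|c1] := eqVneq (size c) 1%N.
  move/eqP/size_poly1P => [e e0 ce]; exists (fun i => (e^-1)%:P%:P * q i), g; split=> // i.
  by rewrite -mulrA -fE ce mulrA -!polyCM mulVf // mul1r.
have /closed_rootP[a ra] := c1.
have /factor_theorem[c' cE] := ra.
have c'0 : c' != 0 by apply: contra_neq c0 => e; rewrite cE e mul0r.
have szc' : (size c' <= N)%N.
  by move: szc; rewrite cE size_Mmonic ?monicXsubC // size_XsubC addn2.
have fE' i : linC a * (c'%:P * f i) = q i * g by rewrite -fE cE polyCM /linC; ring.
have [g0|g0] := eqVneq (at_x a g) 0.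
  have [|q' [g' [fq' sg]]] := IH c' szc' f q (div_lin a g) c'0.
    move=> i; apply: (mulfI (linC_neq0 a)).
    by rewrite fE' {1}(at_x_eq0 g0); ring.
  by exists q', g'; split=> //; rewrite sg [in RHS](at_x_eq0 g0) size_linC_mul.
have q0 i : at_x a (q i) = 0.
  apply: (mulIf g0); rewrite -at_xM -fE' at_xM at_x_lin !mul0r //.
apply: (IH c' szc' f (fun i => div_lin a (q i)) g c'0) => i.
by apply: (mulfI (linC_neq0 a)); rewrite fE' {1}(at_x_eq0 (q0 i)); ring.
Qed.

(** Here the alternative is decided: some [f i] is nonzero at x = a, so every factor x - a of c
    comes out of g. *)
Lemma cancel_content (I : finType) c (f F : I -> B) g : c != 0 ->
  (forall a, exists i, at_x a (f i) != 0) ->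
  (forall i, c%:P * F i = f i * g) -> exists g', forall i, F i = f i * g'.
Proof.
elim: {c}(size c) {-2}c (leqnn (size c)) g => [|N IH] c.
  by rewrite leqn0 size_poly_eq0 => /eqP-> g /eqP.
move=> szc g c0 fa fE; have [|c1] := eqVneq (size c) 1%N.
  move/eqP/size_poly1P => [e e0 ce]; exists ((e^-1)%:P%:P * g) => i.
  rewrite mulrCA -fE ce mulrA -!polyCM mulVf // mul1r //.
have /closed_rootP[a ra] := c1.
have /factor_theorem[c' cE] := ra.
have c'0 : c' != 0 by apply: contra_neq c0 => e; rewrite cE e mul0r.
have szc' : (size c' <= N)%N.
  by move: szc; rewrite cE size_Mmonic ?monicXsubC // size_XsubC addn2.
have fE' i : linC a * (c'%:P * F i) = f i * g by rewrite -fE cE polyCM /linC; ring.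
have [j fj] := fa a.
have g0 : at_x a g = 0.
  by apply: (mulfI fj); rewrite -at_xM -fE' at_xM at_x_lin mulr0 mul0r.
apply: (IH c' szc' (div_lin a g)) => // i.
by apply: (mulfI (linC_neq0 a)); rewrite fE' {1}(at_x_eq0 g0); ring.
Qed.

(** The two sizes together say that g is a nonzero constant of K. *)
Definition common_unit (f : 'I_3 -> B) :=
  forall g, (forall i, exists q, f i = q * g) -> (size g = 1%N) /\ (size (g`_0)%R = 1%N).

(** Over K(x) the gcd has degree 0 in y, and Bezout's relation has its denominators cleared into c.
    Over K[x] the division algorithm only works up to factors from K[x], which [peel_content]
    removes. *)
Lemma common_unit_bezout (f : 'I_3 -> B) : f 0 != 0 -> common_unit f ->
  exists c (b : 'I_3 -> B), c != 0 /\ \sum_i b i * f i = c%:P.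
Proof.
move=> f0 fu; pose g12 := gcdp (f 1) (f 2); pose g := gcdp (f 0) g12.
have dv i : g %| f i.
  case: (unliftP 0 i) => [j ->|->]; last exact: dvdp_gcdl.
  apply: (dvdp_trans (dvdp_gcdr _ _)); case: (unliftP 0 j) => [l ->|->].
    by rewrite (_ : lift 0 (lift 0 l) = 2) ?dvdp_gcdr //; apply/val_inj; rewrite /= ord1.
  by rewrite (_ : lift 0 0 = 1) ?dvdp_gcdl //; apply/val_inj.
have /fin_all_exists[cq cqE] i : exists x : {poly K} * B, x.1 != 0 /\ x.1 *: f i = x.2 * g.
  by have /Pdiv.Idomain.dvdpP[x x0 e] := dv i; exists x.
have [|i|q' [g' [fq' sg]]] :=
    @peel_content _ (\prod_i (cq i).1) f (fun i => (\prod_(j | j != i) (cq j).1)%:P * (cq i).2) g.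
- by apply/prodf_neq0 => i _; have [] := cqE i.
- have [_ e] := cqE i; rewrite -mulrA -e (bigD1 i) //= polyCM -mul_polyC; ring.
have [sg' _] : size g' = 1%N /\ size (g'`_0)%R = 1%N.
  by apply: fu => i; exists (q' i).
have [u] := Bezoutp (f 0) g12; have [v] := Bezoutp (f 1) (f 2).
move=> /Pdiv.Idomain.eqpP[[v1 v2] /= /andP[v10 v20] ev] /Pdiv.Idomain.eqpP[[u1 u2] /= /andP[u10 u20] eu].
move/eqP: sg'; rewrite sg -/g => /size_poly1P[e e0 ge].
exists (v2 * u2 * e); exists (fun i => if i == 0 then (v2 * u1)%:P * u.1 else
   if i == 1 then (u1 * v1)%:P * u.2 * v.1 else (u1 * v1)%:P * u.2 * v.2).
split; first by rewrite !mulf_neq0.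
rewrite !big_ord_recl big_ord0 /= addr0.
have -> : lift ord0 ord0 = 1 :> 'I_3 by apply/val_inj.
have -> : lift ord0 (lift ord0 ord0) = 2 :> 'I_3 by apply/val_inj.
move: ev eu; rewrite -!mul_polyC -/g12 -/g ge => ev eu.
have -> : (v2 * u2 * e)%:P = v2%:P * (u2%:P * e%:P) :> B by rewrite !polyCM mulrA.
rewrite -eu !polyCM mulrDr mulrDr.
have -> : v2%:P * (u1%:P * (u.2 * g12)) = u1%:P * u.2 * (v2%:P * g12) by ring.
by rewrite -ev /=; ring.
Qed.

(** Bezout's relation times [F j], with indices exchanged by proportionality, reads c F_j = f_j (sum
    of b_i F_i); then c is cancelled. *)
Lemma common_unit_proportional (f F : 'I_3 -> B) : f 0 != 0 -> common_unit f ->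
  (forall i j, f i * F j = f j * F i) -> exists g, forall i, F i = f i * g.
Proof.
move=> f0 fu prop; have [c [b [c0 bE]]] := common_unit_bezout f0 fu.
apply: (@cancel_content _ c f F (\sum_i b i * F i)) => // [a|j].
  have [//|] := pickP (fun i => at_x a (f i) != 0); first by move=> i; exists i.
  move=> no; have [|+ _] := fu (linC a).
    by move=> i; exists (div_lin a (f i)); rewrite mulrC -at_x_eq0 //; apply/eqP; rewrite -[_ == _]negbK no.
  have [|_] := fu (linC a).
    by move=> i; exists (div_lin a (f i)); rewrite mulrC -at_x_eq0 //; apply/eqP; rewrite -[_ == _]negbK no.
  by rewrite /linC coefC /= size_XsubC.
rewrite -bE mulr_suml mulr_sumr; apply: eq_bigr => i _.
by rewrite -mulrA prop; ring.
Qed.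

End GaussLemma.

(** * Restriction to lines and homogenization *)

Section BivariatePolynomials.

Variable K : fieldType.
Local Notation A := {mpoly K[2]}.
Local Notation B := {poly {poly K}}.

Definition biv_var (i : 'I_2) : B := if i == 0 then 'X%:P else 'X.
Definition biv : A -> B := mmap (polyC \o (@polyC K)) biv_var.

HB.instance Definition _ := GRing.RMorphism.copy biv
  (mmap (polyC \o (@polyC K)) biv_var).

Definition unbivC (c : {poly K}) : A := horner_eval (mvar 0) (map_poly (@mpolyC 2 K) c).
HB.instance Definition _ := GRing.RMorphism.copy unbivC
  (horner_eval (mvar 0) \o map_poly (@mpolyC 2 K)).

Definition unbiv (q : B) : A := horner_eval (mvar 1) (map_poly unbivC q).
HB.instance Definition _ := GRing.RMorphism.copy unbiv
  (horner_eval (mvar 1) \o map_poly unbivC).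

Lemma bivM p q : biv (p * q) = biv p * biv q.
Proof. exact: rmorphM. Qed.

Lemma unbivX0 : unbiv 'X%:P = mvar 0.
Proof. by rewrite /unbiv map_polyC /= /unbivC map_polyX /= /horner_eval hornerC hornerX. Qed.

Lemma unbivX1 : unbiv 'X = mvar 1.
Proof. by rewrite /unbiv map_polyX /= /horner_eval hornerX. Qed.

Lemma unbivCC c : unbiv c%:P%:P = @mpolyC 2 K c.
Proof. by rewrite /unbiv map_polyC /= /unbivC map_polyC /= /horner_eval !hornerC. Qed.

Lemma bivC c : biv (@mpolyC 2 K c) = c%:P%:P.
Proof. by rewrite /biv mmapC. Qed.

Lemma bivX (i : 'I_2) : biv (mvar i) = biv_var i.
Proof. by rewrite /biv mmapX mmap1U. Qed.

Lemma bivK : cancel biv unbiv.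
Proof.
move=> p; rewrite [in RHS](mpolyE p) {1}/biv /mmap rmorph_sum; apply: eq_bigr => m _.
rewrite rmorphM /= unbivCC mul_mpolyC; congr (_ *: _).
rewrite /mmap1 rmorph_prod [in RHS]mpolyXE_id; apply: eq_bigr => i _.
rewrite rmorphXn /biv_var; congr (_ ^+ _); case: eqP => [->|]; first exact: unbivX0.
case: i => [[|[|//]] hi] /= ne; last by rewrite unbivX1; congr (mpolyX _ (mnm1 _)); apply/val_inj.
by case: ne; apply/val_inj.
Qed.

Lemma unbivK : cancel unbiv biv.
Proof.
elim/poly_ind => [|q c IH]; first by rewrite !rmorph0.
rewrite rmorphD rmorphM /= unbivX1 rmorphD rmorphM /= IH bivX /biv_var /=.
congr (_ + _); elim/poly_ind: c => [|c e IHc]; first by rewrite !rmorph0.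
rewrite polyCD polyCM rmorphD rmorphM /= unbivX0 unbivCC rmorphD rmorphM /= IHc.
by rewrite bivX bivC /biv_var.
Qed.

Definition on_line (eta : K) (p : A) : {poly K} := horner_eval eta%:P (biv p).
HB.instance Definition _ eta := GRing.RMorphism.copy (on_line eta)
  (horner_eval eta%:P \o biv).

Lemma on_lineX0 eta : on_line eta (mvar 0) = 'X.
Proof. by rewrite /on_line bivX /biv_var /= /horner_eval hornerC. Qed.

Lemma on_lineX1 eta : on_line eta (mvar 1) = eta%:P.
Proof. by rewrite /on_line bivX /biv_var /= /horner_eval hornerX. Qed.

Lemma on_lineC eta c : on_line eta (@mpolyC 2 K c) = c%:P.
Proof. by rewrite /on_line bivC /horner_eval hornerC. Qed.

Lemma on_line1 eta : on_line eta 1 = 1.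
Proof. exact: rmorph1. Qed.

Lemma on_lineB eta p q : on_line eta (p - q) = on_line eta p - on_line eta q.
Proof. exact: rmorphB. Qed.

Lemma on_lineM eta p q : on_line eta (p * q) = on_line eta p * on_line eta q.
Proof. exact: rmorphM. Qed.

Lemma size_on_line eta p : (size (on_line eta p) <= msize p)%N.
Proof.
rewrite {1}(mpolyE p) rmorph_sum; apply: (leq_trans (size_sum _ _ _)).
apply/bigmax_leqP_seq => m mp _; apply: leq_trans (msize_mdeg_lt mp).
rewrite -mul_mpolyC rmorphM /= on_lineC mpolyXE_id rmorph_prod /= big_ord_recl big_ord1 /=.
rewrite !rmorphXn /= (_ : lift ord0 ord0 = 1 :> 'I_2); last exact/val_inj.
rewrite on_lineX0 on_lineX1 -polyC_exp mulrC -mulrA -polyCM mulrC mul_polyC.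
apply: (leq_trans (size_scale_leq _ _)); rewrite size_polyXn ltnS mdegE.
by rewrite big_ord_recl leq_addr.
Qed.

(** As a polynomial in y over K[x], p has finitely many roots, and in characteristic 0 the positive
    integers are distinct constants. *)
Lemma on_line_neq0 p : [pchar K] =i pred0 -> p != 0 ->
  exists i : nat, on_line i.+1%:R p != 0.
Proof.
move=> /pcharf0P chK p0; have bp0 : biv p != 0.
  by apply: contra_neq p0 => e; rewrite -(bivK p) e rmorph0.
pose rs : seq {poly K} := [seq (i.+1%:R : K)%:P | i <- iota 0 (size (biv p))].
have [/hasP[x /mapP[i _ ->]] nr|] := boolP (has (predC (root (biv p))) rs).
  by exists i.
rewrite has_predC negbK => rr; have /(max_poly_roots bp0) := rr.
rewrite size_map size_iota ltnn => e; suff: false by []; apply: e.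
rewrite map_inj_uniq ?iota_uniq // => i j /polyC_inj.
wlog: i j / (i <= j)%N => [hw|ij /eqP].
  by have [|/ltnW ji e] := leqP i j; [exact: hw | apply/esym/hw].
rewrite eq_sym -subr_eq0 -natrB // subSS chK subn_eq0 => ji.
by apply/eqP; rewrite eqn_leq ij.
Qed.

End BivariatePolynomials.

Section Homogenization.

Variable K : fieldType.
Local Notation A := {mpoly K[2]}.
Local Notation H := {mpoly K[3]}.

Definition dehom : H -> A := comp_mpoly [tuple 1; mvar (0 : 'I_2); mvar (1 : 'I_2)].
HB.instance Definition _ := GRing.RMorphism.copy dehom
  (comp_mpoly [tuple 1; mvar (0 : 'I_2); mvar (1 : 'I_2)]).

Lemma dehomM p q : dehom (p * q) = dehom p * dehom q.
Proof. exact: rmorphM. Qed.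

Lemma dehomZ c p : dehom (c *: p) = c *: dehom p.
Proof. exact: comp_mpolyZ. Qed.

Definition mnm_drop (m : multinom 3) : multinom 2 := Multinom [tuple m (lift 0 i) | i < 2].
Definition mnm_pad d (m : multinom 2) : multinom 3 :=
  Multinom
    [tuple if unlift 0 i is Some j then m j else (d - mdeg m)%N | i < 3].

Lemma dehomX m : dehom (mpolyX _ m) = mpolyX _ (mnm_drop m).
Proof.
rewrite /dehom comp_mpolyX big_ord_recl [tnth _ _]/= expr1n mul1r [in RHS]mpolyXE_id.
apply: eq_bigr => i _; rewrite mnmE; congr (_ ^+ _).
by case: i => [[|[|//]] hi] /=; congr (mpolyX _ (mnm1 _)); apply/val_inj.
Qed.

Lemma mdeg_drop (m : multinom 3) : mdeg m = (m ord0 + mdeg (mnm_drop m))%N.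
Proof. by rewrite !mdegE big_ord_recl; congr (_ + _)%N; apply: eq_bigr => i _; rewrite mnmE. Qed.

Lemma mnm_padK d m : mnm_drop (mnm_pad d m) = m.
Proof. by apply/mnmP => i; rewrite !mnmE liftK. Qed.

Lemma mdeg_pad d m : (mdeg m <= d)%N -> mdeg (mnm_pad d m) = d.
Proof. by move=> md; rewrite mdeg_drop mnm_padK mnmE unlift_none subnK. Qed.

Lemma mnm_dropK d m : mdeg m = d -> mnm_pad d (mnm_drop m) = m.
Proof.
move=> md; apply/mnmP => i; rewrite mnmE; case: unliftP => [j ->|->].
  by rewrite mnmE.
by rewrite -md mdeg_drop addnK.
Qed.

Lemma dehomE p : dehom p = \sum_(m <- msupp p) mcoeff m p *: mpolyX _ (mnm_drop m).
Proof. by rewrite {1}(mpolyE p) raddf_sum /=; apply: eq_bigr => m _; rewrite dehomZ dehomX. Qed.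

Lemma msize_dehom d p : p \is ishomog1 d mdeg -> (msize (dehom p) <= d.+1)%N.
Proof.
move=> /dhomogP hp; rewrite dehomE; apply: (leq_trans (msize_sum _ _ _)).
apply/bigmax_leqP_seq => m mp _; apply: (leq_trans (msizeZ_le _ _)).
by rewrite msizeX ltnS -(hp m mp) /= mdeg_drop leq_addl.
Qed.

Lemma dehom_eq0 d p : p \is ishomog1 d mdeg -> dehom p = 0 -> p = 0.
Proof.
move=> /dhomogP hp p0; apply/mpolyP => m; rewrite mcoeff0.
have [mp|/memN_msupp_eq0//] := boolP (m \in msupp p).
have := congr1 (mcoeff (mnm_drop m)) p0; rewrite dehomE raddf_sum /= mcoeff0.
rewrite (bigD1_seq m) ?msupp_uniq //= mcoeffZ mcoeffX eqxx mulr1.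
rewrite big_seq_cond big1 ?addr0 // => m' /andP[m'p m'm].
rewrite mcoeffZ mcoeffX; case: eqP => [e|_]; last by rewrite mulr0.
by case/eqP: m'm; rewrite -(mnm_dropK (hp _ m'p)) e (mnm_dropK (hp _ mp)).
Qed.

Lemma dehom_inj d p q : p \is ishomog1 d mdeg -> q \is ishomog1 d mdeg ->
  dehom p = dehom q -> p = q.
Proof.
move=> hp hq e; apply/eqP; rewrite -subr_eq0; apply/eqP; apply: (@dehom_eq0 d).
  by rewrite rpredB.
by rewrite rmorphB /= e subrr.
Qed.

Lemma dehom_surj d (p : A) : (msize p <= d.+1)%N ->
  exists2 P : H, P \is ishomog1 d mdeg & dehom P = p.
Proof.
move=> pd; exists (\sum_(m <- msupp p) mcoeff m p *: mpolyX _ (mnm_pad d m)).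
  rewrite big_seq; apply: rpred_sum => m mp; apply: rpredZ.
  by rewrite dhomogX /= mdeg_pad // -ltnS (leq_trans (msize_mdeg_lt mp)).
rewrite [RHS]mpolyE raddf_sum /=; apply: eq_bigr => m _.
by rewrite dehomZ dehomX mnm_padK.
Qed.

Lemma dehom_drop d p : p \is ishomog1 d mdeg -> (msize (dehom p) <= d)%N ->
  exists q, p = q * mvar 0.
Proof.
case: d => [|d] hp sp.
  exists 0; rewrite mul0r; apply: (dehom_eq0 hp); apply/eqP.
  by rewrite -msize_poly_eq0 -leqn0.
have [q hq e] := dehom_surj sp; exists q.
apply: (@dehom_inj d.+1) => //.
  by rewrite -[X in ishomog1 X]addn1; apply: dhomogM => //; rewrite dhomogX /= mdeg1.
by rewrite rmorphM /= e /dehom comp_mpolyXU /= mulr1.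
Qed.

Lemma mpoly_unit_msize n (p : {mpoly K[n]}) : p \is a GRing.unit = (msize p == 1%N).
Proof.
apply/idP/idP => [/andP[/eqP e u]|/msize_poly1P[c c0 ->]].
  by rewrite e msizeC; move: u; rewrite unitfE => ->.
by rewrite -[_ \is a _]/(_ && _) mpolyCK eqxx unitfE.
Qed.

End Homogenization.

(** * Presentations of minimal degree *)

Local Open Scope complex_scope.

Lemma cross_proportional (A : idomainType) (p0 q0 p q p' q' : A) : p0 != 0 -> q0 != 0 ->
  p * q0 = p0 * q -> p' * q0 = p0 * q' -> p * q' = p' * q.
Proof.
move=> hp hq e e'; apply: (mulfI hp); apply: (mulfI hq).
have -> : q0 * (p0 * (p * q')) = (p * q0) * (p0 * q') by ring.
by rewrite e -e'; ring.
Qed.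

Section Presentations.

Variable R : realType.
Local Notation C := R[i].
Local Notation A := {mpoly C[2]}.
Local Notation H := {mpoly C[3]}.
Local Notation tofrac := FracField.tofrac.

(** A common factor of degree e is homogenized in degree e and its cofactors in degree d - e. A form
    of degree d is determined by its dehomogenization, so the result is a common factor of the forms
    themselves, hence a unit. *)
Lemma common_unit_dehom d (f : 'I_3 -> H) : (forall i, f i \is ishomog1 d mdeg) ->
  no_common_factor f -> dehom (f 0) != 0 -> common_unit (fun i => biv (dehom (f i))).
Proof.
move=> fd ncf f0 g gE.
have {}gE i : exists q, dehom (f i) = q * unbiv g.
  by have [q /= e] := gE i; exists (unbiv q); rewrite -rmorphM -e /= bivK.
have h0 : unbiv g != 0.
  by have [q e] := gE 0; apply: contra_neq f0 => h0; rewrite e h0 mulr0.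
set h := unbiv g in gE h0; pose e := (msize h).-1.
have he : msize h = e.+1 by rewrite /e prednK // lt0n msize_poly_eq0.
have sq q i : dehom (f i) = q * h -> q != 0 -> (msize q + e <= d.+1)%N.
  move=> fE q0; have := msize_dehom (fd i); by rewrite fE (msizeM q0 h0) he addnS.
have ed : (e <= d)%N.
  have [q fE] := gE 0; have q0 : q != 0.
    by apply: contra_neq f0 => q0; rewrite fE q0 mul0r.
  have := sq _ _ fE q0; have : (0 < msize q)%N by rewrite lt0n msize_poly_eq0.
  lia.
have [P Pe PE] := @dehom_surj _ e h (eq_leq he).
have uP : P \is a GRing.unit.
  apply: ncf => i; have [q fE] := gE i.
  have sq' : (msize q <= (d - e).+1)%N.
    have [->|q0] := eqVneq q 0; first by rewrite msize0.
    by have := sq _ _ fE q0; lia.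
  have [Q Qe QE] := dehom_surj sq'; exists Q; apply: (dehom_inj (fd i)).
    by rewrite -[X in ishomog1 X](subnK ed); apply: dhomogM.
  by rewrite rmorphM /= QE PE.
move: uP; rewrite mpoly_unit_msize => /msize_poly1P[c c0 Pc].
have -> : g = c%:P%:P.
  rewrite -[g]unbivK -/h -PE Pc -bivC; congr biv.
  by rewrite /dehom /= comp_mpolyC.
by rewrite coefC /= !size_polyC polyC_eq0 c0.
Qed.

Definition represents (phi : ratmap R) (q : 'I_3 -> A) :=
  [/\ q 0 != 0, phi.1 = tofrac (q 1) / tofrac (q 0) & phi.2 = tofrac (q 2) / tofrac (q 0)].

Lemma dehomogenizeE (p : H) : dehomogenize p = tofrac (dehom p).
Proof. by []. Qed.

Lemma presentation_represents phi d f : projective_presentation phi d f ->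
  represents phi (fun i => dehom (f i)).
Proof.
move=> [_ _]; rewrite !dehomogenizeE tofrac_eq0 => f0 e1 e2.
by split; [exact: f0 | exact: e1 | exact: e2].
Qed.

Lemma represents_proportional phi p q : represents phi p -> represents phi q ->
  forall i j, p i * q j = p j * q i.
Proof.
move=> [p0 p1 p2] [q0 q1 q2].
have t0 (r : A) : r != 0 -> tofrac r != 0 by rewrite tofrac_eq0.
have e1 : p 1 * q 0 = q 1 * p 0.
  apply/eqP; rewrite -tofrac_eq !tofracM -eqr_div ?t0 //; by rewrite -p1 -q1.
have e2 : p 2 * q 0 = q 2 * p 0.
  apply/eqP; rewrite -tofrac_eq !tofracM -eqr_div ?t0 //; by rewrite -p2 -q2.
have key i : p i * q 0 = p 0 * q i.
  case: (unliftP 0 i) => [j ->|->] //.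
  case: (unliftP 0 j) => [l ->|->].
    rewrite (_ : lift 0 (lift 0 l) = 2) ?e2 1?mulrC //.
    by apply/val_inj; rewrite /= ord1.
  by rewrite (_ : lift 0 0 = 1) ?e1 1?mulrC //; apply/val_inj.
move=> i j; exact: cross_proportional p0 q0 (key i) (key j).
Qed.

Lemma presentation_minimal phi d f D q : projective_presentation phi d f ->
  represents phi q -> (forall i, msize (q i) <= D.+1)%N -> (d <= D)%N.
Proof.
move=> pf rq qD; have rf := presentation_represents pf.
have [fd ncf _ _ _] := pf; have [/= f0 _ _] := rf.
have bf0 : biv (dehom (f 0)) != 0 by apply: contra_neq f0 => e; rewrite -[LHS]bivK e rmorph0.
have [|g gE] := common_unit_proportional (F := fun i => biv (q i)) bf0
   (common_unit_dehom fd ncf f0).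
  move=> i j; have /(congr1 (@biv C)) := represents_proportional rf rq i j.
  by rewrite !bivM.
have {}gE i : q i = dehom (f i) * unbiv g.
  by rewrite -[LHS]bivK gE rmorphM /= bivK.
have g0 : unbiv g != 0.
  by have [q0 _ _] := rq; apply: contra_neq q0 => e; rewrite gE e mulr0.
(* If every component lost degree under dehomogenization, the coordinate X_0 would be a common
   factor. *)
have [j fj] : exists j, (d < msize (dehom (f j)))%N.
  apply: contrapT => no; have : mvar (0 : 'I_3) \is a @GRing.unit H.
    apply: ncf => i; apply: (dehom_drop (fd i)).
    by rewrite leqNgt; apply/negP => h; apply: no; exists i.
  by rewrite mpoly_unit_msize msizeX mdeg1.
have fj0 : dehom (f j) != 0.
  by rewrite -msize_poly_eq0 -lt0n (leq_ltn_trans _ fj).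
have gp : (0 < msize (unbiv g))%N by rewrite lt0n msize_poly_eq0.
have := qD j; rewrite gE (msizeM fj0 g0); move: fj gp.
move: (msize (dehom (f j))) (msize (unbiv g)) => a b; lia.
Qed.

(** From f_2 D = T f_0 and coprimality on the line, D divides f_0 there. The line is chosen so that
    f_0 does not vanish on it; this is why coprimality is required on a whole sequence of lines. *)
Lemma presentation_lower phi d f (T D : A) : projective_presentation phi d f ->
  D != 0 -> phi.2 = tofrac T / tofrac D ->
  (forall i : nat, coprimep (on_line i.+1%:R T) (on_line i.+1%:R D)) ->
  exists i : nat, (size (on_line i.+1%:R D) <= d.+1)%N.
Proof.
move=> pf D0 phiE cop; have [f0 _ f2] := presentation_represents pf.
have [fd _ _ _ _] := pf.
have [i fi] := on_line_neq0 (pchar_num C) f0.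
exists i; have e : dehom (f 2) * D = T * dehom (f 0).
  apply/eqP; rewrite -tofrac_eq !tofracM -eqr_div ?tofrac_eq0 //.
  by apply/eqP; move: f2; rewrite phiE /= => ->.
apply: leq_trans (msize_dehom (fd 0)); apply: leq_trans (size_on_line i.+1%:R _).
have cDT : coprimep (on_line i.+1%:R D) (on_line i.+1%:R T) by rewrite coprimep_sym; exact: cop.
apply: (dvdp_leq fi); rewrite -(Gauss_dvdpr _ cDT).
by rewrite -rmorphM -e rmorphM dvdp_mulIr.
Qed.

End Presentations.

(** * Leading homogeneous components of products *)

Section TopComponents.

Variables (K : fieldType) (n : nat).
Implicit Types p q h : {mpoly K[n]}.

Lemma msize_dhomog d p : p \is ishomog1 d mdeg -> (msize p <= d.+1)%N.
Proof.
by move=> /dhomogP hp; rewrite msizeE; apply/bigmax_leqP_seq => m /hp <- _.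
Qed.

Lemma pihomog_low d p : (msize p <= d)%N -> pihomog mdeg d p = 0.
Proof.
move=> pd; rewrite pihomogE big_seq_cond big_pred0 // => m; apply/andP => -[mp /eqP md].
by have := leq_trans (msize_mdeg_lt mp) pd; rewrite -md ltnn.
Qed.

Lemma top_split d p : (msize p <= d.+1)%N ->
  exists2 r, (msize r <= d)%N & p = r + pihomog mdeg d p.
Proof.
move=> pd; exists (\sum_(i < d) pihomog mdeg i p).
  apply: (leq_trans (msize_sum _ _ _)); apply/bigmax_leqP => i _.
  by apply: leq_trans (msize_dhomog (pihomogP _ _ _)) _.
by rewrite {1}(pihomog_partitionE pd) big_ord_recr.
Qed.

Lemma msizeM_leq p q a b : (msize p <= a.+1)%N -> (msize q <= b.+1)%N ->
  (msize (p * q) <= (a + b).+1)%N.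
Proof.
move=> pa qb; have [->|p0] := eqVneq p 0; first by rewrite mul0r msize0.
have [->|q0] := eqVneq q 0; first by rewrite mulr0 msize0.
by rewrite msizeM //; move: pa qb; move: (msize p) (msize q) => x y; lia.
Qed.

Lemma pihomogM a b p q : (msize p <= a.+1)%N -> (msize q <= b.+1)%N ->
  pihomog mdeg (a + b)%N (p * q) = pihomog mdeg a p * pihomog mdeg b q.
Proof.
move=> pa qb; have [r ra pE] := top_split pa; have [s sb qE] := top_split qb.
set p' := pihomog mdeg a p in pE *; set q' := pihomog mdeg b q in qE *.
have hp' : p' \is ishomog1 a mdeg by exact: pihomogP.
have hq' : q' \is ishomog1 b mdeg by exact: pihomogP.
have low (x y : {mpoly K[n]}) i j : (msize x <= i)%N -> (msize y <= j.+1)%N -> (i + j = a + b)%N ->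
    pihomog mdeg (a + b)%N (x * y) = 0.
  move=> xi yj ij; apply: pihomog_low.
  have [->|x0] := eqVneq x 0; first by rewrite mul0r msize0.
  have [->|y0] := eqVneq y 0; first by rewrite mulr0 msize0.
  by rewrite msizeM //; move: xi yj; move: (msize x) (msize y) => x' y'; lia.
have -> : p * q = r * q + s * p' + p' * q' by rewrite {1}pE [q in LHS]qE [q in r * q]qE; ring.
have rq : pihomog mdeg (a + b)%N (r * q) = 0 by apply: (low _ _ a b).
have sp' : pihomog mdeg (a + b)%N (s * p') = 0.
  by apply: (low _ _ b a); rewrite ?msize_dhomog // addnC.
rewrite !pihomogD rq sp' !add0r; apply: pihomog_dE; exact: dhomogM.
Qed.

End TopComponents.

Lemma tofrac_cancel (A : idomainType) (a b k : A) : k != 0 ->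
  FracField.tofrac (a * k) / FracField.tofrac (b * k) =
  FracField.tofrac a / FracField.tofrac b.
Proof. by move=> k0; rewrite !tofracM -mulf_div divff ?mulr1 ?tofrac_eq0. Qed.

(** * Existence of presentations in lowest terms *)

Section Existence.

Variable R : realType.
Local Notation C := R[i].
Local Notation A := {mpoly C[2]}.
Local Notation H := {mpoly C[3]}.
Local Notation tofrac := FracField.tofrac.

(** The factor h may be inhomogeneous. Taking leading components in f_i = q_i h replaces it by a
    homogeneous factor of the same positive degree. *)
Lemma common_factor_reduce d (f : 'I_3 -> H) h (q : 'I_3 -> H) :
  (forall i, f i \is ishomog1 d mdeg) -> f 0 != 0 -> (forall i, f i = q i * h) ->
  h \isn't a GRing.unit ->
  exists d' (g : 'I_3 -> H) (k : H), [/\ (d' < d)%N, forall i, g i \is ishomog1 d' mdeg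
    & forall i, f i = g i * k].
Proof.
move=> fd f0 fE nu.
have h0 : h != 0 by apply: contra_neq f0 => e; rewrite fE e mulr0.
have q0 : q 0 != 0 by apply: contra_neq f0 => e; rewrite fE e mul0r.
have sh : (1 < msize h)%N.
  by move: h0 nu; rewrite mpoly_unit_msize -msize_poly_eq0; case: (msize h) => [|[]].
pose a := (msize h).-1; have ha : (msize h = a.+1) by rewrite /a prednK // ltnW.
have sq i : q i != 0 -> (msize (q i) + a <= d.+1)%N.
  by move=> qi0; have := msize_dhomog (fd i); rewrite fE (msizeM qi0 h0) ha addnS.
have ad : (a <= d)%N.
  by have := sq 0 q0; move: q0; rewrite -msize_poly_eq0; move: (msize (q 0)) => x; lia.
exists (d - a)%N, (fun i => pihomog mdeg (d - a) (q i)), (pihomog mdeg a h); split.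
- by move: ha sh; move: (msize h) => x; lia.
- by move=> i; apply: pihomogP.
move=> i; rewrite -pihomogM ?ha // ?subnK //.
  by rewrite -fE pihomog_dE.
have [->|qi0] := eqVneq (q i) 0; first by rewrite msize0.
by have := sq i qi0; move: (msize (q i)) => x; lia.
Qed.

Lemma homogeneous_presentation (phi : ratmap R) d (f : 'I_3 -> H) :
  (forall i, f i \is ishomog1 d mdeg) -> represents phi (fun i => dehom (f i)) ->
  exists d' f', projective_presentation phi d' f'.
Proof.
elim/ltn_ind: d f => d IH f fd [/= f0 phi1 phi2].
have [ncf|/existsNP[h /not_implyP[hf nu]]] := pselect (no_common_factor f).
  exists d, f; split; [exact: fd | exact: ncf | | |]; rewrite !dehomogenizeE.
  - by rewrite tofrac_eq0.
  - exact: phi1.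
  - exact: phi2.
have hf' i : {q | f i = q * h} by apply: cid.
have F0 : f 0 != 0 by apply: contra_neq f0 => ->; rewrite rmorph0.
have [|d' [g [k [d'd gd gE]]]] :=
  @common_factor_reduce d f h (fun i => sval (hf' i)) fd F0 (fun i => svalP (hf' i)).
  exact/negP.
have gD i : dehom (f i) = dehom (g i) * dehom k by rewrite gE dehomM.
have k0 : dehom k != 0 by apply: contra_neq f0 => e; rewrite gD e mulr0.
have g0 : dehom (g 0) != 0 by apply: contra_neq f0 => e; rewrite gD e mul0r.
apply: (IH d' d'd g gd); split; [exact: g0 | | ].
  by rewrite phi1 (gD 1) (gD 0); exact: (tofrac_cancel _ _ k0).
by rewrite phi2 (gD 2) (gD 0); exact: (tofrac_cancel _ _ k0).
Qed.

Lemma presentation_exists (phi : ratmap R) q : represents phi q ->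
  exists d f, projective_presentation phi d f.
Proof.
move=> [q0 e1 e2].
pose d := \max_i msize (q i).
have qd i : exists P : H, P \is ishomog1 d mdeg /\ dehom P = q i.
  have [|P Pd PE] := @dehom_surj _ d (q i); last by exists P.
  by apply: leqW; apply: (leq_bigmax (F := fun i => msize (q i))).
have /fin_all_exists[f fE] := qd.
apply: (@homogeneous_presentation phi d f); first by move=> i; have [] := fE i.
have fE' i : dehom (f i) = q i by have [] := fE i.
by split; rewrite !fE'.
Qed.

(** Existence rules out the default value of [xget]. The degree bounds hold for every presentation,
    so it does not matter which degree is selected. *)
Lemma ratmap_degree_presentation (phi : ratmap R) q : represents phi q ->
  exists f, projective_presentation phi (ratmap_degree phi) f.
Proof.
move=> /presentation_exists[d [f pf]]; rewrite /ratmap_degree.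
case: xgetP => [d' -> //|/(_ d) no]; by case: no; exists f.
Qed.

Lemma ratmap_degree_upper (phi : ratmap R) D q : represents phi q ->
  (forall i, msize (q i) <= D.+1)%N -> (ratmap_degree phi <= D)%N.
Proof.
by move=> rq qD; have [f pf] := ratmap_degree_presentation rq; apply: (presentation_minimal pf rq).
Qed.

Lemma ratmap_degree_lower (phi : ratmap R) N q (T D : A) : represents phi q ->
  D != 0 -> phi.2 = tofrac T / tofrac D ->
  (forall i : nat, coprimep (on_line i.+1%:R T) (on_line i.+1%:R D)) ->
  (forall i : nat, N < size (on_line i.+1%:R D))%N -> (N <= ratmap_degree phi)%N.
Proof.
move=> rq D0 phiE cop sD; have [f pf] := ratmap_degree_presentation rq.
have [j] := presentation_lower pf D0 phiE cop.
by move=> h; rewrite -ltnS; exact: leq_trans (sD j) h.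
Qed.

End Existence.

(** * From states to iterates of k_F *)

Lemma kinv_map (A B : comNzRingType) (f : {rmorphism A -> B}) n (s : kstate A) :
  kinv n s -> kinv n (kstate_map f s).
Proof.
move=> [h1 h2]; split; rewrite /kstate_map /=.
  by rewrite -rmorphD h1 rmorphM.
by rewrite -rmorphM h2 rmorphXn.
Qed.

Lemma knext_map (A B : comNzRingType) (f : {rmorphism A -> B}) n h (s s' : kstate A) :
  knext n h s s' -> knext n (f \o h) (kstate_map f s) (kstate_map f s').
Proof.
move=> [h1 h2 h3 h4 h5]; split; rewrite /kstate_map /=.
- by rewrite h1 rmorphM.
- by rewrite h2.
- by rewrite h3 rmorphN rmorphD rmorphM.
- by rewrite h4 rmorphB rmorphM.
by rewrite -rmorphM h5 rmorphD !rmorphM rmorphXn homog_eval_rmorph.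
Qed.

Lemma odd_inv_map (A B : comNzRingType) (f : {rmorphism A -> B}) n h (s : kstate A) :
  odd_inv n h s -> odd_inv n (f \o h) (kstate_map f s).
Proof.
move=> [h1 h2 h3]; split; rewrite /kstate_map /=.
- by rewrite h1 rmorphM.
- by rewrite h2 rmorphM !rmorphXn.
by rewrite -rmorphM h3 rmorphD !rmorphM homog_eval_rmorph.
Qed.

Section AffinePoint.

Variables (L : fieldType) (n : nat) (h : nat -> L).
Implicit Type s : kstate L.

Definition state_u s := kN s / (kM s * kT' s).
Definition state_y s := kT s / kD s.

Lemma homog_eval_div (t d : L) : d != 0 ->
  homog_eval n h t d / d ^+ n = homog_eval n h (t / d) 1.
Proof.
move=> d0; rewrite /homog_eval mulr_suml; apply: eq_bigr => j _.
have jn : (j <= n)%N by rewrite -ltnS.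
rewrite expr1n mulr1 expr_div_n -!mulrA; congr (_ * (_ * _)).
by rewrite -[in d ^+ n](subnKC jn) exprD invfM mulrCA divff ?mulr1 // expf_neq0.
Qed.

(** The link between the polynomial recursion and k: the conclusions are the formulas for y' and u',
    E being eliminated by [kinvM]. *)
Lemma state_step s s' : kinv n s -> kinv n s' -> knext n h s s' ->
  [/\ kT s != 0, kT' s != 0, kD s != 0, kM s != 0 & kN s != 0] ->
  kD s' != 0 -> kE s != 0 -> kE s' != 0 ->
  - state_y s - 1 - state_y s / state_u s = state_y s' /\
  state_u s + state_u s / state_y s + homog_eval n h (state_y s') 1 = state_u s'.
Proof.
move=> [hW hM] [_ hM'] [eD eT' eW eT eN] [T0 T'0 D0 M0 N0] D'0 E0 E'0; split.
  rewrite /state_y /state_u eT eD eW; field.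
  by rewrite T'0 M0 D0 N0.
have M'0 : kM s' != 0.
  by apply: contraTneq (expf_neq0 n D'0) => e; rewrite -hM' e mul0r eqxx.
rewrite [X in homog_eval _ _ X]/state_y -homog_eval_div // /state_u eT'.
have -> : kN s' / (kM s' * kT s) = kN s' * kE s' / (kD s' ^+ n * kT s).
  rewrite -hM'; field; by rewrite E'0 T0 M'0.
have Dn : kD s' ^+ n = kM s * kE s * kN s ^+ n by rewrite hM eD exprMn.
have Nn : kN s ^+ n != 0 by rewrite expf_neq0.
have W' : kW s = (kT s + kD s) / kT' s by rewrite hW mulrC mulKf.
rewrite eN Dn exprS W' /state_y.
by field; rewrite T0 Nn M0 E0 D0 T'0.
Qed.

End AffinePoint.

(** * Total degrees of the entries of a state *)

Section DegreeBounds.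

Variables (K : fieldType) (N : nat).
Local Notation A := {mpoly K[N]}.
Implicit Types p q t d : A.

Definition mdeg_le p k := (msize p <= k.+1)%N.

Lemma mdeg_leW p k l : mdeg_le p k -> (k <= l)%N -> mdeg_le p l.
Proof. by move=> h kl; apply: leq_trans h _. Qed.

Lemma mdeg_leC c k : mdeg_le (@mpolyC N K c) k.
Proof. by rewrite /mdeg_le msizeC; case: (c != 0). Qed.

Lemma mdeg_le1 k : mdeg_le 1 k.
Proof. by rewrite /mdeg_le msize1. Qed.

Lemma mdeg_le0 k : mdeg_le 0 k.
Proof. by rewrite /mdeg_le msize0. Qed.

Lemma mdeg_leX i k : (0 < k)%N -> mdeg_le (mvar i) k.
Proof. by move=> k0; rewrite /mdeg_le msizeX mdeg1. Qed.

Lemma mdeg_leN p k : mdeg_le p k -> mdeg_le (- p) k.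
Proof. by rewrite /mdeg_le msizeN. Qed.

Lemma mdeg_leD p q k : mdeg_le p k -> mdeg_le q k -> mdeg_le (p + q) k.
Proof.
by move=> hp hq; apply: (leq_trans (msizeD_le _ _)); rewrite geq_max; apply/andP.
Qed.

Lemma mdeg_leB p q k : mdeg_le p k -> mdeg_le q k -> mdeg_le (p - q) k.
Proof. by move=> hp hq; apply: mdeg_leD => //; apply: mdeg_leN. Qed.

Lemma mdeg_leM p q k l : mdeg_le p k -> mdeg_le q l -> mdeg_le (p * q) (k + l).
Proof. exact: msizeM_leq. Qed.

Lemma mdeg_leXn p k j : mdeg_le p k -> mdeg_le (p ^+ j) (j * k).
Proof.
move=> hp; elim: j => [|j IH]; first by rewrite expr0; exact: mdeg_le1.
by rewrite exprS mulSn; apply: mdeg_leM.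
Qed.

Lemma mdeg_le_sum (I : Type) (r : seq I) (P : pred I) (F : I -> A) k :
  (forall i, P i -> mdeg_le (F i) k) -> mdeg_le (\sum_(i <- r | P i) F i) k.
Proof.
move=> hF; elim/big_rec: _ => [|i x Pi hx]; first exact: mdeg_le0.
by apply: mdeg_leD => //; apply: hF.
Qed.

Variable (n : nat) (c : nat -> K).
Local Notation h := (@mpolyC N K \o c).

Lemma mdeg_le_homog_eval t d k : mdeg_le t k -> mdeg_le d k ->
  mdeg_le (homog_eval n h t d) (n * k).
Proof.
move=> ht hd; apply: mdeg_le_sum => j _; have jn : (j <= n)%N by rewrite -ltnS.
have -> : (n * k = j * k + (n - j) * k)%N by rewrite -mulnDl subnKC.
apply: mdeg_leM; last exact: mdeg_leXn.
by rewrite -[X in mdeg_le _ X]add0n; apply: mdeg_leM; [exact: mdeg_leC | exact: mdeg_leXn].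
Qed.

(** The weights make both summands of the new N have the same bound; W gets a - a' because it is the
    quotient of T + D by T'. *)
Record even_bound (s : kstate A) (a a' : nat) : Prop := EvenBound {
  even_boundT : mdeg_le (kT s) a; even_boundD : mdeg_le (kD s) a;
  even_boundT' : mdeg_le (kT' s) a'; even_boundM : mdeg_le (kM s) (n * a);
  even_boundN : mdeg_le (kN s) (n * a + a'); even_boundW : mdeg_le (kW s) (a - a');
  even_bound_le : (a' <= a)%N }.

Lemma even_step_bound s a a' : even_bound s a a' ->
  even_bound (even_step n h s) (n * a + a' + a) a.
Proof.
move=> [hT hD hT' hM hN hW aa].
have hW' : mdeg_le (nextW s) (n * a + a').
  apply: mdeg_leN; apply: mdeg_leD => //; apply: mdeg_leW (mdeg_leM hT' hM) _; lia.
have hD' : mdeg_le (nextD s) (n * a + a' + a).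
  by apply: mdeg_leW (mdeg_leM hD hN) _; lia.
have hTn : mdeg_le (nextT s) (n * a + a' + a).
  by apply: mdeg_leB => //; apply: mdeg_leW (mdeg_leM hT hW') _; lia.
split=> //=.
- exact: mdeg_leXn.
- apply: mdeg_leD.
    by apply: mdeg_leW (mdeg_leM hT (mdeg_le_homog_eval hTn hD')) _; rewrite addnC.
  apply: mdeg_leW (mdeg_leM (mdeg_leXn n.+1 hN) hW) _.
  by rewrite mulSn !mulnDr; lia.
- by rewrite addnK.
by rewrite leq_addl.
Qed.

(* e and e1 bound the degrees of E and P = E(m+1). *)
Record odd_bound (s : kstate A) (e e1 a' : nat) : Prop := OddBound {
  odd_boundT : mdeg_le (kT s) (e + e1); odd_boundD : mdeg_le (kD s) (e + e1);
  odd_boundT' : mdeg_le (kT' s) a'; odd_boundE : mdeg_le (kE s) e;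
  odd_boundP : mdeg_le (kP s) e1; odd_boundM : mdeg_le (kM s) (n * e1 + n.-1 * e);
  odd_boundN : mdeg_le (kN s) (n * e1 + n.-1 * e + a');
  odd_boundW : mdeg_le (kW s) (e + e1 - a');
  odd_boundX : mdeg_le (kX s) (n.-1 * e1 + n * e + a');
  odd_bound_le : (a' <= e + e1)%N }.

(** The degree identities for one odd step, with p = n - 1, v the bound for N and w the bound for N
    E, the next P. *)
Lemma odd_weights (p e e1 a' v w : nat) : (a' <= e + e1)%N ->
  (v = p.+1 * e1 + p * e + a')%N -> (w = p.+1 * e1 + p.+1 * e + a')%N ->
  [/\ [/\ w = v + e, e + e1 + v = e1 + w, e + e1 + a' + p * e1 + p * e <= w
      & forall r j, r + j = p ->
        0 + r.+1 * v + e + r * (e + e1) + j * (e1 + w) = p * (e1 + w) + w],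
    [/\ p.+1 * w + p * e1 + (e + e1) = (e + e1) + (p * (e1 + w) + w),
      p * e1 + p.+1 * e + a' + (e + e1 - a') = e + p.+1 * (e + e1)
    & p.+1 * v + (e + p.+1 * (e + e1)) = (e + e1) + (p * (e1 + w) + w)]
  & [/\ v = e1 + w - (e + e1), p.+1 * v + (e + e1 - a') = p * w + p.+1 * e1 + (e + e1)
    & e + e1 <= e1 + w]]%N.
Proof.
move=> /subnKC aa; move: (e + e1 - a')%N aa => b ab -> ->.
split; split; rewrite ?mulSn ?mulnDr -?ab; nia.
Qed.

Lemma odd_step_bound s e e1 a' : (0 < n)%N -> odd_bound s e e1 a' ->
  odd_bound (odd_step n h s) e1 (n * e1 + n * e + a') (e + e1).
Proof.
move=> n0 [hT hD hT' hE hP hM hN hW hX aa].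
set w := (n * e1 + n * e + a')%N; set v := (n * e1 + n.-1 * e + a')%N in hN.
have vE : v = (n.-1.+1 * e1 + n.-1 * e + a')%N by rewrite prednK.
have wE : w = (n.-1.+1 * e1 + n.-1.+1 * e + a')%N by rewrite prednK.
have [[wv F2 F5 F6] [F9 F10 F11] [F12 F13 F14]] := odd_weights aa vE wE.
rewrite !prednK // in F9 F10 F11 F12 F13.
have F3 : (v + (e + e1))%N = (e1 + w)%N by rewrite addnC.
have hW' : mdeg_le (nextW s) v.
  apply: mdeg_leN; apply: mdeg_leD => //.
  by apply: mdeg_leW (mdeg_leM hT' hM) _; rewrite addnC.
have hD' : mdeg_le (nextD s) (e1 + w) by rewrite -F2; exact: mdeg_leM.
have hTn : mdeg_le (nextT s) (e1 + w).
  by apply: mdeg_leB => //; rewrite -F2; exact: mdeg_leM.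
have hNT : mdeg_le (kN s * kT s) (e1 + w) by rewrite -F3; exact: mdeg_leM.
have hP' : mdeg_le (kN s * kE s) w by rewrite wv; exact: mdeg_leM.
have hH : mdeg_le (homog_eval n h (kT s) (kD s)) (n * (e + e1)).
  exact: mdeg_le_homog_eval.
have hV : mdeg_le (odd_V n s) w.
  apply: mdeg_leD; first by rewrite wv addnC; exact: mdeg_leM.
  exact: mdeg_leW (mdeg_leM (mdeg_leM (mdeg_leM hT hT') (mdeg_leXn _ hP)) (mdeg_leXn _ hE)) F5.
have hK : mdeg_le (odd_K n h s) (n.-1 * (e1 + w) + w).
  apply: mdeg_leB.
    apply: mdeg_le_sum => j _.
    have jn : (n - j)%N = (n.-1 - j).+1 by rewrite -subSn ?prednK // -ltnS prednK.
    have hS : mdeg_le (nextT s ^+ j + (kN s * kT s) ^+ j) (j * (e1 + w)).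
      by apply: mdeg_leD; apply: mdeg_leXn.
    have := mdeg_leM (mdeg_leM (mdeg_leM (mdeg_leM (mdeg_leC (c j) 0) (mdeg_leXn (n - j) hN)) hE)
      (mdeg_leXn (n - j).-1 hD)) hS.
    by rewrite jn F6 // subnK // -ltnS prednK.
  have hS : mdeg_le (\sum_(i < n) nextT s ^+ (n.-1 - i) * (- (kN s * kT s)) ^+ i)
     (n.-1 * (e1 + w)).
    apply: mdeg_le_sum => i _.
    have := mdeg_leM (mdeg_leXn (n.-1 - i) hTn) (mdeg_leXn i (mdeg_leN hNT)).
    by rewrite -mulnDl subnK // -ltnS prednK.
  have := mdeg_leM (mdeg_leM (mdeg_leC (c n) 0) hV) hS.
  by rewrite add0n addnC.
split.
- exact: hTn.
- exact: hD'.
- exact: hT.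
- exact: hP.
- exact: hP'.
- exact: mdeg_leM (mdeg_leXn n hP') (mdeg_leXn n.-1 hP).
- rewrite F9; apply: mdeg_leD; first exact: mdeg_leM hT hK.
  have hS : mdeg_le (kE s * homog_eval n h (kT s) (kD s) + kX s * kW s) (e + n * (e + e1)).
    by apply: mdeg_leD; [exact: mdeg_leM | rewrite -F10; exact: mdeg_leM].
  by rewrite -F11; exact: mdeg_leM (mdeg_leXn n hN) hS.
- by rewrite -F12; exact: hW'.
- by rewrite -F13; exact: mdeg_leM (mdeg_leXn n hN) hW.
exact: F14.
Qed.

End DegreeBounds.

(** * The orbit of the generic point *)

Section GenericOrbit.

Variables (R : realType) (n : nat) (F : {poly R[i]}).
Hypothesis sizeF : (size F <= n.+1)%N.
Local Notation C := R[i].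
Local Notation A := {mpoly C[2]}.
Local Notation tofrac := FracField.tofrac.

(* Coefficients of H = F - 1: in the coordinate u = x - 1 the involution j_F
   reads u |-> H(y) - 1 - u. *)
Definition shifted_coef (j : nat) : C := F`_j - (j == 0%N)%:R.

Definition generic_u : A := mvar 0 - 1.
Definition generic_y : A := mvar 1.

Variable s : nat -> kstate A.
Hypothesis s_inv : forall m, kinv n (s m).
Hypothesis s_next : forall m, knext n (@mpolyC 2 C \o shifted_coef) (s m) (s m.+1).
Hypothesis s_init :
  [/\ kT (s 0%N) = generic_y, kT' (s 0%N) = 1, kD (s 0%N) = 1, kM (s 0%N) = 1
    & kN (s 0%N) = generic_u].

Lemma on_line_coef eta : on_line eta \o (@mpolyC 2 C \o shifted_coef) =
  (fun j => (shifted_coef j)%:P).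
Proof. by apply/funext => j; rewrite /comp on_lineC. Qed.

Lemma succ_neq0 (i : nat) : ((i.+1%:R : C) != 0) && (i.+1%:R + 1 != 0 :> C).
Proof. by rewrite natr1 !pnatr_eq0. Qed.

Lemma orbit_at_infinity i m : exists theta,
  at_infinity theta (kstate_map (on_line i.+1%:R) (s m)).
Proof.
elim: m => [|m [theta IH]].
  have [hT hT' hD hM hN] := s_init.
  exists i.+1%:R; apply: at_infinity_start; rewrite /kstate_map /=.
  - exact: succ_neq0.
  - by rewrite hT /generic_y on_lineX1.
  - by rewrite hT' on_line1.
  - by rewrite hD on_line1.
  - by rewrite hM on_line1.
  by rewrite hN /generic_u on_lineB on_line1 on_lineX0.
exists (- 1 - theta).
have knx := knext_map (on_line i.+1%:R) (s_next m).
rewrite on_line_coef in knx.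
exact: at_infinity_next (kinv_map (on_line i.+1%:R) (s_inv m))
  (kinv_map (on_line i.+1%:R) (s_inv m.+1)) knx IH.
Qed.

Lemma on_line_neq0_inv (p : A) : on_line (1%:R : C) p != 0 -> p != 0.
Proof. by apply: contra_neq => ->; rewrite rmorph0. Qed.

(** Nonvanishing in C[x, y] is read off the line y = 1, on which [at_infinity] makes all these
    entries nonzero. *)
Lemma orbit_neq0 m :
  [/\ kT (s m) != 0, kT' (s m) != 0, kD (s m) != 0, kM (s m) != 0 & kN (s m) != 0] /\
  kE (s m) != 0.
Proof.
have [theta hs] := orbit_at_infinity 0 m.
have hi := kinv_map (on_line (1%:R : C)) (s_inv m).
have [T0 E0 M0 N0] := at_infinity_neq0 hi hs; have [D0 T'0 _ _ _] := hs.
split; last exact: on_line_neq0_inv E0.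
split; [exact: on_line_neq0_inv T0 | exact: on_line_neq0_inv T'0 |
  exact: on_line_neq0_inv D0 | exact: on_line_neq0_inv M0 | exact: on_line_neq0_inv N0].
Qed.

Lemma ratconst_coef j : (map_poly (@ratconst R) F)`_j = @ratconst R F`_j.
Proof. by rewrite coef_map_id0 // /ratconst mpolyC0 tofrac0. Qed.

Lemma horner_shifted (y : ratfun R) : (map_poly (@ratconst R) F).[y] =
  homog_eval n (@FracField.tofrac _ \o (@mpolyC 2 C \o shifted_coef)) y 1 + 1.
Proof.
rewrite (horner_coef_wide (n := n.+1)); last exact: leq_trans (size_poly _ _) sizeF.
rewrite /homog_eval !big_ord_recl /= !expr0 !mulr1 expr1n mulr1 ratconst_coef.
rewrite /shifted_coef eqxx mpolyCB tofracB mpolyC1 tofrac1.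
rewrite [RHS]addrAC subrK; congr (_ + _); apply: eq_bigr => j _.
by rewrite ratconst_coef expr1n mulr1 /= subr0.
Qed.

Lemma kmap_iterE m : kmap_iter F m =
  (tofrac (kN (s m)) / (tofrac (kM (s m)) * tofrac (kT' (s m))) + 1,
   tofrac (kT (s m)) / tofrac (kD (s m))).
Proof.
elim: m => [|m IH].
  have [hT hT' hD hM hN] := s_init.
  rewrite /kmap_iter /= hT hT' hD hM hN tofrac1 mulr1 !divr1.
  by rewrite /generic_u tofracB tofrac1 subrK.
have [[T0 T'0 D0 M0 N0] E0] := orbit_neq0 m; have [[T1 T'1 D1 M1 N1] E1] := orbit_neq0 m.+1.
have t0 (p : A) : p != 0 -> tofrac p != 0 by rewrite tofrac_eq0.
have [e1 e2] := state_step (kinv_map (@FracField.tofrac _) (s_inv m)) (kinv_map (@FracField.tofrac _) (s_inv m.+1))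
  (knext_map (@FracField.tofrac _) (s_next m))
  (And5 (t0 _ T0) (t0 _ T'0) (t0 _ D0) (t0 _ M0) (t0 _ N0)) (t0 _ D1) (t0 _ E0) (t0 _ E1).
rewrite /state_u /state_y /kstate_map /= in e1 e2.
rewrite /kmap_iter iterS -/(kmap_iter F m) IH /kmap /comp /iota_map /jmath_map.
rewrite !addrK e1; congr pair; rewrite horner_shifted -e2.
move: (homog_eval _ _ _ _) => H.
move: (tofrac (kN _) / _) => u; move: (tofrac (kT _) / _) => y.
by move: (u / y) => w; ring.
Qed.

Definition orbit_rep m (i : 'I_3) : A :=
  if i == 0 then kM (s m) * kT' (s m) * kD (s m) else
  if i == 1 then (kN (s m) + kM (s m) * kT' (s m)) * kD (s m)
  else kT (s m) * (kM (s m) * kT' (s m)).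

Lemma orbit_represents m : represents (kmap_iter F m) (orbit_rep m).
Proof.
have [[T0 T'0 D0 M0 N0] E0] := orbit_neq0 m.
have MT0 := mulf_neq0 M0 T'0.
rewrite kmap_iterE /orbit_rep; split.
- exact: (mulf_neq0 MT0 D0).
- rewrite /= (tofrac_cancel _ _ D0) tofracD mulrDl tofracM divff //.
  by rewrite -tofracM tofrac_eq0.
by rewrite /= [kM _ * kT' _ * kD _]mulrC (tofrac_cancel _ _ MT0).
Qed.

Lemma orbit_degree_upper m w :
  mdeg_le (kM (s m) * kT' (s m)) w.1 -> mdeg_le (kN (s m)) w.1 ->
  mdeg_le (kT (s m)) w.2 -> mdeg_le (kD (s m)) w.2 ->
  (ratmap_degree (kmap_iter F m) <= w.1 + w.2)%N.
Proof.
move=> hM hN hT hD; apply: (ratmap_degree_upper (orbit_represents m)) => i.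
rewrite /orbit_rep; case: ifP => _; first exact: (mdeg_leM hM hD).
case: ifP => _; first exact: (mdeg_leM (mdeg_leD hN hM) hD).
by rewrite addnC; exact: (mdeg_leM hT hM).
Qed.

Lemma orbit_degree_lower m w :
  (forall (i : nat) (sigma : C), ((on_line i.+1%:R (kT (s m))).[sigma] != 0) ||
     ((on_line i.+1%:R (kD (s m))).[sigma] != 0)) ->
  (forall i : nat, w = pdeg (on_line i.+1%:R (kD (s m)))) ->
  (w <= ratmap_degree (kmap_iter F m))%N.
Proof.
move=> cop sw; have [[T0 T'0 D0 M0 N0] E0] := orbit_neq0 m.
apply: (ratmap_degree_lower (T := kT (s m)) (orbit_represents m) D0).
- by rewrite kmap_iterE.
- by move=> i; apply: coprimep_no_root; exact: cop.
move=> i; rewrite (sw i) /pdeg prednK // size_poly_gt0.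
by have [theta [+ _ _ _ _]] := orbit_at_infinity i m.
Qed.

Lemma orbit_line_neq0 (i m : nat) : [/\ on_line (i.+1%:R : C) (kD (s m)) != 0,
  on_line (i.+1%:R : C) (kE (s m)) != 0 & on_line (i.+1%:R : C) (kN (s m)) != 0].
Proof.
have [theta hs] := orbit_at_infinity i m.
have hi := kinv_map (on_line (i.+1%:R : C)) (s_inv m).
have [T0 E0 M0 N0] := at_infinity_neq0 hi hs; have [D0 _ _ _ _] := hs.
by split; [exact: D0 | exact: E0 | exact: N0].
Qed.

Lemma orbit_pdegN (i m : nat) : let d (p : A) := pdeg (on_line i.+1%:R p) in
  (d (kN (s m)) + d (kE (s m)) = n * d (kD (s m)) + d (kT' (s m)) + 1)%N.
Proof.
have [theta hs] := orbit_at_infinity i m.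
exact: at_infinity_pdegN (kinv_map (on_line (i.+1%:R : C)) (s_inv m)) hs.
Qed.

Lemma orbit_pdegD (i m : nat) : let d (p : A) := pdeg (on_line i.+1%:R p) in
  d (kD (s m.+1)) = (d (kD (s m)) + d (kN (s m)))%N /\ d (kT' (s m.+1)) = d (kD (s m)).
Proof.
have [theta hs] := orbit_at_infinity i m.
have knx := knext_map (on_line (i.+1%:R : C)) (s_next m).
rewrite on_line_coef in knx.
exact: at_infinity_pdegD (kinv_map (on_line (i.+1%:R : C)) (s_inv m)) hs knx.
Qed.

End GenericOrbit.

(** * Degree complexity *)

Section Weights.

Variables (n d : nat).

(* With d = 1 these count the degrees in x on a line y = const, where u has one
   extra simple pole at infinity; with d = 0 they bound total degrees. *)
Definition even_weight (t : nat * nat) := (n * t.1 + t.2 + t.1 + d, t.1)%N.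

Definition odd_weight (t : nat * nat * nat) :=
  (t.1.2, n * t.1.2 + n * t.1.1 + t.2 + d, t.1.1 + t.1.2)%N.

End Weights.

Lemma even_weight_next (n D N E T' D1 T1 : nat) w : D = w.1 -> T' = w.2 -> E = 0%N ->
  (N + E = n * D + T' + 1)%N -> (D1 = D + N)%N -> T1 = D ->
  D1 = (even_weight n 1 w).1 /\ T1 = (even_weight n 1 w).2.
Proof. by case: w => w1 w2 /= -> -> -> + -> ->; split=> //; lia. Qed.

Lemma odd_weight_next (n D N E P T' E1 P1 T1 : nat) w :
  E = w.1.1 -> P = w.1.2 -> T' = w.2 -> D = (E + P)%N ->
  (N + E = n * D + T' + 1)%N -> T1 = D -> E1 = P -> P1 = (N + E)%N ->
  [/\ E1 = (odd_weight n 1 w).1.1, P1 = (odd_weight n 1 w).1.2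
    & T1 = (odd_weight n 1 w).2].
Proof.
case: w => -[w1 w2] w3 /= -> -> -> -> eN -> -> ->; split=> //.
by rewrite eN mulnDr; lia.
Qed.

Section CommonGrowth.

Variables (R : realType) (F : {poly R[i]}).

(** Convergence is stated separately because [limn] also returns a value for divergent sequences.
    Positivity of [lo] is asked from index 1 on, since both counts of poles used below start at
    0. *)
Lemma degree_complexity_growth (p : {poly R}) (delta : R) (c2 c1 c0 : nat) (lo hi : nat -> nat) :
  0 < delta -> largest_root p delta ->
  delta ^+ 3 = c2%:R * delta ^+ 2 + c1%:R * delta + c0%:R ->
  (forall m, hi m.+3 <= c2 * hi m.+2 + c1 * hi m.+1 + c0 * hi m)%N ->
  (forall m, c2 * lo m.+2 + c1 * lo m.+1 + c0 * lo m <= lo m.+3)%N ->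
  (forall m, 0 < lo m.+1)%N ->
  (forall m, lo m <= ratmap_degree (kmap_iter F m) <= hi m)%N ->
  cvgn (degree_roots F) /\ largest_root p (degree_complexity F).
Proof.
move=> d0 hp hr hhi hlo lo0 hdeg.
have [K2 K20 hK2] := recurrence_upper d0 hr hhi.
have [K1 K10 hK1] := recurrence_lower d0 hr (lo0 0%N) (lo0 1%N) (lo0 2%N) hlo.
have cv : degree_roots F @ \oo --> delta.
  apply: (cvg_root_growth (m0 := 1%N) d0 K10 K20) => [m m1|m].
    by apply: (le_trans (hK1 m m1)); rewrite ler_nat; have /andP[] := hdeg m.
  by apply: le_trans (hK2 m); rewrite ler_nat; have /andP[] := hdeg m.
split; first by apply/cvg_ex; exists delta.
by rewrite /degree_complexity (cvg_lim _ cv).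
Qed.

End CommonGrowth.

Section EvenCase.

Variables (R : realType) (n : nat) (F : {poly R[i]}).
Hypothesis sizeF : (size F <= n.+1)%N.
Local Notation C := R[i].
Local Notation A := {mpoly C[2]}.
Local Notation c := (shifted_coef F).
Local Notation hA := (@mpolyC 2 C \o c).

Definition even_orbit m : kstate A :=
  iter m (even_step n hA) (even_init (generic_u R) (generic_y R)).

Lemma even_orbit_inv m : kinv n (even_orbit m).
Proof. by case: m => [|m]; [exact: even_init_inv | exact: even_step_inv]. Qed.

Lemma even_orbit_E m : kE (even_orbit m) = 1.
Proof. by case: m. Qed.

Lemma even_orbit_next m : knext n hA (even_orbit m) (even_orbit m.+1).
Proof. exact: even_step_next (even_orbit_E m). Qed.

Lemma generic_u_bound k : mdeg_le (generic_u R) k.+1.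
Proof. by apply: mdeg_leB; [exact: mdeg_leX | exact: mdeg_le1]. Qed.

Lemma generic_y_bound k : mdeg_le (generic_y R) k.+1.
Proof. exact: mdeg_leX. Qed.

(** The start (2, 1) leaves room for u when n = 0, where N is bounded by a' alone, and then for W =
    y + 1, of degree 1 = a - a'. *)
Lemma even_orbit_bound m : let w := iter m (even_weight n 0) (2, 1)%N in
  even_bound n (even_orbit m) w.1 w.2.
Proof.
elim: m => [|m IH] /=.
  split; [exact: generic_y_bound | exact: mdeg_le1 | exact: mdeg_le1 | exact: mdeg_le1 |
    by rewrite /= addn1; exact: generic_u_bound | | by []].
  by apply: mdeg_leD; [exact: generic_y_bound | exact: mdeg_le1].
by rewrite addn0; exact: even_step_bound.
Qed.

Let init : [/\ kT (even_orbit 0) = generic_y R, kT' (even_orbit 0) = 1, kD (even_orbit 0) = 1,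
  kM (even_orbit 0) = 1 & kN (even_orbit 0) = generic_u R].
Proof. by split. Qed.

Lemma even_orbit_pdeg i m : let w := iter m (even_weight n 1) (0, 0)%N in
  pdeg (on_line (i.+1%:R : C) (kD (even_orbit m))) = w.1 /\
  pdeg (on_line (i.+1%:R : C) (kT' (even_orbit m))) = w.2.
Proof.
elim: m => [|m [IH1 IH2]]; first by split; rewrite /= on_line1 /pdeg size_poly1.
have [eD eT'] := orbit_pdegD even_orbit_inv even_orbit_next init i m.
have eN := orbit_pdegN even_orbit_inv even_orbit_next init i m.
have E0 : pdeg (on_line (i.+1%:R : C) (kE (even_orbit m))) = 0%N.
  by rewrite even_orbit_E on_line1 /pdeg size_poly1.
exact: (even_weight_next IH1 IH2 E0 eN eD eT').
Qed.

Lemma iter_step_map (A B : comNzRingType) (f : {rmorphism A -> B})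
  (stA : kstate A -> kstate A) (stB : kstate B -> kstate B) s m :
  (forall s, kstate_map f (stA s) = stB (kstate_map f s)) ->
  kstate_map f (iter m stA s) = iter m stB (kstate_map f s).
Proof. by move=> hst; elim: m => [//|m IH]; rewrite /= hst IH. Qed.

Definition at_point (eta sigma : C) : A -> C := horner_eval sigma \o on_line eta.
HB.instance Definition _ eta sigma := GRing.RMorphism.copy (at_point eta sigma)
  (horner_eval sigma \o on_line eta).

Lemma at_point_coef eta sigma : at_point eta sigma \o hA = c.
Proof. by apply/funext => j; rewrite /comp /at_point /= on_lineC /horner_eval hornerC. Qed.

Lemma even_orbit_at_point (eta sigma : C) m :
  kstate_map (at_point eta sigma) (even_orbit m) =
  iter m (even_step n c)
    (kstate_map (at_point eta sigma) (even_init (generic_u R) (generic_y R))).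
Proof.
apply: iter_step_map => s.
by rewrite (kstate_map_even_step (at_point eta sigma)) at_point_coef.
Qed.

Lemma at_point_init (eta sigma : C) s : eta != 0 ->
  kT s = generic_y R -> kT' s = 1 -> kD s = 1 ->
  regular c (kstate_map (at_point eta sigma) s).
Proof.
move=> e0 hT hT' hD; apply: Or31; rewrite /at_generic /kstate_map /= hT hT' hD.
rewrite /at_point /= on_line1 /generic_y on_lineX1 /horner_eval !hornerC.
by rewrite e0 oner_neq0.
Qed.

Hypothesis n_even : ~~ odd n.
Hypothesis coef_n : (0 < n)%N -> c n != 0.
Hypothesis zorbit_neq0 : forall j, zorbit c j != 0.
Hypothesis const_neq0 : n = 0%N ->
  forall j, (c 0%N *+ j.+1 != 0) /\ (c 0%N *+ j + 1 != 0).

Lemma even_orbit_coprime m (i : nat) (sigma : C) :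
  ((on_line i.+1%:R (kT (even_orbit m))).[sigma] != 0) ||
  ((on_line i.+1%:R (kD (even_orbit m))).[sigma] != 0).
Proof.
have i0 : (i.+1%:R : C) != 0 by rewrite pnatr_eq0.
pose f := at_point i.+1%:R sigma.
pose s0 := kstate_map f (even_init (generic_u R) (generic_y R)).
have r0 : regular c s0 by exact: at_point_init.
have k0 : kinv n s0 := kinv_map f (even_init_inv _ _ _).
have E0 : kE s0 = 1 by rewrite /s0 /kstate_map /=; exact: rmorph1.
suff : let s := iter m (even_step n c) s0 in (kT s != 0) || (kD s != 0).
  by rewrite /s0 -even_orbit_at_point.
have [n0|n0] := posnP n.
  apply: const_orbit_TD => //; by move=> j; have [] := const_neq0 n0 j.
apply: even_orbit_TD => //; last exact: coef_n.
exact: pchar_num.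
Qed.

Lemma even_case : cvgn (degree_roots F) /\
  largest_root ('X^2 - n.+1%:R *: 'X - 1) (degree_complexity F).
Proof.
have [delta d0 [dmax dE]] := even_largest_root R n.
apply: (@degree_complexity_growth _ _ _ delta n.+1 1 0
  (fun m => (iter m (even_weight n 1) (0, 0)%N).1)
  (fun m => (iter m.+1 (even_weight n 0) (2, 1)%N).1)) => //.
- by move=> m /=; rewrite !mulSn; lia.
- by move=> m /=; rewrite !mulSn; lia.
- by move=> m /=; rewrite addn1.
move=> m; apply/andP; split.
  apply: (orbit_degree_lower sizeF even_orbit_inv even_orbit_next init).
    exact: even_orbit_coprime.
  by move=> i; exact: esym (even_orbit_pdeg i m).1.
have [hT hD hT' hM hN hW _] := even_orbit_bound m.
(* The representing triple has degree at most (n a + a') + a, which is the next weight; hence the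
   shift to [m.+1] in the upper sequence. *)
rewrite /= addn0.
exact: (orbit_degree_upper sizeF even_orbit_inv even_orbit_next init (w := (_, _))
  (mdeg_leM hM hT') hN hT hD).
Qed.

End EvenCase.

Lemma odd_weight_total (n e e1 a' : nat) : (0 < n)%N ->
  (n * e1 + n.-1 * e + a' + (e + e1) = e1 + (n * e1 + n * e + a' + 0))%N.
Proof. by case: n => [//|n] _; rewrite /= mulSn; lia. Qed.

Section OddCase.

Variables (R : realType) (n : nat) (F : {poly R[i]}).
Hypothesis sizeF : (size F <= n.+1)%N.
Hypothesis n_odd : odd n.
Local Notation C := R[i].
Local Notation A := {mpoly C[2]}.
Local Notation c := (shifted_coef F).
Local Notation hA := (@mpolyC 2 C \o c).

Let n_gt0 : (0 < n)%N. Proof. by case: n n_odd. Qed.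

Definition odd_orbit m : kstate A :=
  iter m (odd_step n hA) (odd_init n hA (generic_u R) (generic_y R)).

Lemma odd_orbit_invs m : kinv n (odd_orbit m) /\ odd_inv n hA (odd_orbit m).
Proof.
elim: m => [|m [IH1 IH2]]; first exact: odd_init_inv.
rewrite /odd_orbit iterS -/(odd_orbit m); exact: (odd_step_inv n_odd IH1 IH2).
Qed.

Lemma odd_orbit_inv m : kinv n (odd_orbit m).
Proof. exact: (odd_orbit_invs m).1. Qed.

Lemma odd_orbit_next m : knext n hA (odd_orbit m) (odd_orbit m.+1).
Proof.
have [hi ho] := odd_orbit_invs m.
by rewrite [odd_orbit m.+1]iterS -/(odd_orbit m); exact: (odd_step_next n_odd hi ho).
Qed.

(** The start (1, 1, 1) gives W = y + 1 the bound e + e1 - a' = 1 and X = u - H(y) the bound 2 n. *)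
Lemma odd_orbit_bound m : let w := iter m (odd_weight n 0) (1, 1, 1)%N in
  odd_bound n (odd_orbit m) w.1.1 w.1.2 w.2.
Proof.
elim: m => [|m IH].
  split; [exact: generic_y_bound | exact: mdeg_le1 | exact: mdeg_le1 | exact: mdeg_le1 |
    exact: mdeg_le1 | exact: mdeg_le1 | by rewrite /= addn1; exact: generic_u_bound | | | by []].
    by apply: mdeg_leD; [exact: generic_y_bound | exact: mdeg_le1].
  rewrite /= addn1; apply: mdeg_leB; first exact: generic_u_bound.
  apply: mdeg_leW (mdeg_le_homog_eval _ _ (generic_y_bound _ 0) (mdeg_le1 _ _ _)) _.
  by rewrite leqW // leq_addl.
rewrite [odd_orbit m.+1]iterS -/(odd_orbit m) iterS.
move: (iter m _ (1, 1, 1)%N) IH => [[e e1] a'] /= IH.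
by rewrite addn0; exact: odd_step_bound.
Qed.

Let init : [/\ kT (odd_orbit 0) = generic_y R, kT' (odd_orbit 0) = 1, kD (odd_orbit 0) = 1,
  kM (odd_orbit 0) = 1 & kN (odd_orbit 0) = generic_u R].
Proof. by split. Qed.

Lemma odd_orbit_pdeg (i m : nat) : let w := iter m (odd_weight n 1) (0, 0, 0)%N in
  let d (p : A) := pdeg (on_line i.+1%:R p) in
  [/\ d (kE (odd_orbit m)) = w.1.1, d (kP (odd_orbit m)) = w.1.2 & d (kT' (odd_orbit m)) = w.2].
Proof.
elim: m => [|m [IH1 IH2 IH3]]; first by split; rewrite /= on_line1 /pdeg size_poly1.
have [_ eT'] := orbit_pdegD odd_orbit_inv odd_orbit_next init i m.
have eN := orbit_pdegN odd_orbit_inv odd_orbit_next init i m.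
have [D0 E0 N0] := orbit_line_neq0 odd_orbit_inv odd_orbit_next init i m.
have DE := congr1 (on_line (i.+1%:R : C)) (odd_invD (odd_orbit_invs m).2).
rewrite on_lineM in DE.
have P0 : on_line (i.+1%:R : C) (kP (odd_orbit m)) != 0.
  by apply: contra_neq D0 => P0; rewrite DE P0 mulr0.
have dD := etrans (congr1 (@pdeg _) DE) (pdegM E0 P0).
have dP := etrans (congr1 (@pdeg _) (on_lineM _ (kN (odd_orbit m)) (kE (odd_orbit m))))
  (pdegM N0 E0).
exact: (odd_weight_next IH1 IH2 IH3 dD eN eT' erefl dP).
Qed.

Lemma odd_orbit_pdegD (i m : nat) : let w := iter m (odd_weight n 1) (0, 0, 0)%N in
  (w.1.1 + w.1.2)%N = pdeg (on_line (i.+1%:R : C) (kD (odd_orbit m))).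
Proof.
have [IH1 IH2 _] := odd_orbit_pdeg i m.
have [D0 E0 N0] := orbit_line_neq0 odd_orbit_inv odd_orbit_next init i m.
have DE := congr1 (on_line (i.+1%:R : C)) (odd_invD (odd_orbit_invs m).2).
rewrite on_lineM in DE.
have P0 : on_line (i.+1%:R : C) (kP (odd_orbit m)) != 0.
  by apply: contra_neq D0 => P0; rewrite DE P0 mulr0.
have dD := etrans (congr1 (@pdeg _) DE) (pdegM E0 P0).
exact: esym (etrans dD (congr2 addn IH1 IH2)).
Qed.

Lemma odd_orbit_at_point (eta sigma : C) m :
  kstate_map (at_point eta sigma) (odd_orbit m) =
  iter m (odd_step n c)
    (kstate_map (at_point eta sigma) (odd_init n hA (generic_u R) (generic_y R))).
Proof.
apply: iter_step_map => s.
by rewrite (kstate_map_odd_step (at_point eta sigma)) at_point_coef.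
Qed.

Hypothesis coef_n : c n != 0.
Hypothesis zorbit_neq0 : forall j, zorbit c j != 0.
Hypothesis kappa_neq0 : forall j, odd_kappa n c *+ j.+1 != 0.
Hypothesis kappa1 : n = 1%N -> forall j, odd_kappa n c *+ j + 1 != 0.

Lemma odd_orbit_coprime m (i : nat) (sigma : C) :
  ((on_line i.+1%:R (kT (odd_orbit m))).[sigma] != 0) ||
  ((on_line i.+1%:R (kD (odd_orbit m))).[sigma] != 0).
Proof.
have i0 : (i.+1%:R : C) != 0 by rewrite pnatr_eq0.
pose f := at_point i.+1%:R sigma.
pose s0 := kstate_map f (odd_init n hA (generic_u R) (generic_y R)).
have r0 : regular c s0 by exact: at_point_init.
have k0 : kinv n s0 := kinv_map f (odd_orbit_invs 0).1.
have o0 : odd_inv n c s0.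
  by have := odd_inv_map f (odd_orbit_invs 0).2; rewrite at_point_coef.
suff : let s := iter m (odd_step n c) s0 in (kT s != 0) || (kD s != 0).
  by rewrite /s0 -odd_orbit_at_point.
by apply: odd_orbit_TD.
Qed.

Lemma odd_case : cvgn (degree_roots F) /\
  largest_root ('X^3 - n%:R *: 'X^2 - n.+1%:R *: 'X - 1) (degree_complexity F).
Proof.
have [delta d0 [dmax dE]] := odd_largest_root R n.
apply: (@degree_complexity_growth _ _ _ delta n n.+1 1
  (fun m => let w := iter m (odd_weight n 1) (0, 0, 0)%N in (w.1.1 + w.1.2)%N)
  (fun m => let w := iter m.+1 (odd_weight n 0) (1, 1, 1)%N in (w.1.1 + w.1.2)%N)) => //.
(* Put A = e + e1. Up to the surplus d, a' is the preceding A and e1 is n times the preceding A plus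
   the one before it; eliminating both leaves the third-order recurrence for A. *)
- move=> m; rewrite !iterS; move: (iter m _ _) => [[e e1] a'] /=.
  by rewrite !mulSn !mulnDr; lia.
- move=> m; rewrite !iterS; move: (iter m _ _) => [[e e1] a'] /=.
  by rewrite !mulSn !mulnDr; lia.
- by move=> m /=; rewrite addn1 addnS.
move=> m; apply/andP; split.
  apply: (orbit_degree_lower sizeF odd_orbit_inv odd_orbit_next init).
    exact: odd_orbit_coprime.
  by move=> i; exact: odd_orbit_pdegD.
have [hT hD hT' hE hP hM hN hW hX aa] := odd_orbit_bound m.
have := orbit_degree_upper sizeF odd_orbit_inv odd_orbit_next init (w := (_, _))
  (mdeg_leM hM hT') hN hT hD.
rewrite iterS; move: (iter m _ (1, 1, 1)%N) => [[e e1] a'] /= h; apply: leq_trans h _.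
by rewrite odd_weight_total.
Qed.

End OddCase.

(** * Generic parameters *)

Section GenericParameters.

Variables (R : realType) (n : nat).
Local Notation C := R[i].
Implicit Type a : 'I_n.+1 -> C.

(** The exceptional sets are the zero sets of the [q i]; one parameter a0 off all of them shows that
    each is proper. *)
Lemma for_generic_polys (q : nat -> {mpoly C[n.+1]}) a0 (P : ('I_n.+1 -> C) -> Prop) :
  (forall i, meval a0 (q i) != 0) ->
  (forall a, a ord_max != 0 -> (forall i, meval a (q i) != 0) -> P a) ->
  for_generic_parameters P.
Proof.
move=> q0 hP; exists (fun i => [set a | meval a (q i) = 0]); split=> [i|a an hA].
  split.
    exists [set q i]; apply/seteqP; split=> a /=; first by move=> e p ->.
    by move=> h; apply: h.
  by move=> /seteqP[_ /(_ a0 I) /= e]; have := q0 i; rewrite e eqxx.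
apply: hP => // i; apply/eqP => e; apply: hA; by exists i.
Qed.

Lemma poly_of_coefsE a j : (poly_of_coefs a)`_j = if insub j is Some i then a i else 0.
Proof.
rewrite /poly_of_coefs coef_sum; under eq_bigr do rewrite coefZ coefXn.
case: insubP => [i _ <-|nj].
  rewrite (bigD1 i) //= eqxx mulr1 big1 ?addr0 // => l li.
  by rewrite eq_sym (inj_eq val_inj) (negbTE li) mulr0.
rewrite big1 // => l _; case: eqP => [e|_]; last by rewrite mulr0.
by move: nj; rewrite e ltn_ord.
Qed.

Lemma size_poly_of_coefs a : (size (poly_of_coefs a) <= n.+1)%N.
Proof.
apply: (leq_trans (size_sum _ _ _)); apply/bigmax_leqP => j _.
by apply: leq_trans (size_scale_leq _ _) _; rewrite size_polyXn.
Qed.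

Lemma shifted_coef_ord a (i : 'I_n.+1) :
  shifted_coef (poly_of_coefs a) i = a i - (i == 0%N :> nat)%:R.
Proof. by rewrite /shifted_coef poly_of_coefsE valK. Qed.

Definition coef_poly (i : 'I_n.+1) : {mpoly C[n.+1]} := mvar i - (i == 0%N :> nat)%:R.

Lemma meval_coef_poly a i : meval a (coef_poly i) = shifted_coef (poly_of_coefs a) i.
Proof.
by rewrite shifted_coef_ord /coef_poly mevalB mevalXU rmorph_nat.
Qed.

Definition zorbit_poly (j : nat) : {mpoly C[n.+1]} :=
  coef_poly ord0 - 1 + (coef_poly ord0 + 1) *+ j.

Lemma meval_zorbit_poly a j :
  meval a (zorbit_poly j) = zorbit (shifted_coef (poly_of_coefs a)) j.
Proof.
by rewrite /zorbit_poly /zorbit !(meval_coef_poly, mevalD, mevalN, mevalMn, meval1).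
Qed.

Definition kappa_poly : {mpoly C[n.+1]} :=
  coef_poly (inord n.-1) *+ 2 + coef_poly ord_max - coef_poly ord_max *+ n - (n == 1%N)%:R.

Lemma meval_kappa_poly a :
  meval a kappa_poly = odd_kappa n (shifted_coef (poly_of_coefs a)).
Proof.
rewrite /kappa_poly /odd_kappa !(meval_coef_poly, mevalD, mevalN, mevalMn, meval1).
by rewrite inordK // ltnS leq_pred.
Qed.

(** F = y^n - 1, or F = -1 for n = 0. Then H(0) = -2, so [zorbit] takes the values - (j + 3), and
    [odd_kappa] is -5 for n = 1 and 1 - n for odd n > 1. *)
Definition sample_parameter (i : 'I_n.+1) : C :=
  if i == 0%N :> nat then -1 else if i == n :> nat then 1 else 0.

Lemma sample_zorbit_neq0 j :
  zorbit (shifted_coef (poly_of_coefs sample_parameter)) j != 0.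
Proof.
rewrite /zorbit (shifted_coef_ord _ ord0) /sample_parameter /=.
have -> : (- 1 - 1%:R - 1 + (- 1 - 1%:R + 1) *+ j : C) = - (j + 3)%:R.
  by rewrite natrD -mulr_natr; ring.
by rewrite oppr_eq0 pnatr_eq0 addn_eq0 andbF.
Qed.

Lemma natrB_neq0 (p q : nat) : p != q -> (p%:R - q%:R : C) != 0.
Proof. by rewrite subr_eq0 eqr_nat. Qed.

End GenericParameters.

Lemma even_generic (R : realType) (n : nat) : ~~ odd n ->
  for_generic_parameters (fun a : 'I_n.+1 -> R[i] =>
    cvgn (degree_roots (poly_of_coefs a)) /\
    largest_root ('X^2 - n.+1%:R *: 'X - 1) (degree_complexity (poly_of_coefs a))).
Proof.
(* For n = 0 the leading coefficient of H is a_0 - 1, so the conditions at y = infinity become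
   polynomial conditions of their own; for n > 0 they follow from a_n being nonzero. *)
move=> n_even; have [n0|n0] := posnP n.
  subst n; pose c0 := coef_poly R (@ord0 0).
  apply: (for_generic_polys
    (q := fun j => zorbit_poly R 0 j * (c0 *+ j.+1 * (c0 *+ j + 1)))
    (a0 := @sample_parameter R 0)) => [j|a _ hq].
    rewrite /c0 !(meval_zorbit_poly, meval_coef_poly, mevalM, mevalD, mevalMn, meval1).
    rewrite !mulf_neq0 ?sample_zorbit_neq0 //.
      rewrite -mulr_natr mulf_neq0 ?pnatr_eq0 //.
      rewrite (shifted_coef_ord _ ord0) /sample_parameter /=.
      have -> : (- 1 - 1%:R : R[i]) = - 2%:R by ring.
      by rewrite oppr_eq0 pnatr_eq0.
    rewrite (shifted_coef_ord _ ord0) /sample_parameter /=.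
    have -> : ((- 1 - 1%:R) *+ j + 1 : R[i]) = 1%:R - (2 * j)%:R.
      by rewrite natrM -mulr_natr; ring.
    by apply: natrB_neq0; apply/eqP; lia.
  have {}hq j : [/\ zorbit (shifted_coef (poly_of_coefs a)) j != 0,
      shifted_coef (poly_of_coefs a) 0 *+ j.+1 != 0 &
      shifted_coef (poly_of_coefs a) 0 *+ j + 1 != 0].
    have := hq j; rewrite /c0 !(meval_zorbit_poly, meval_coef_poly, mevalM, mevalD, mevalMn, meval1).
    by rewrite !mulf_eq0 !negb_or => /and3P[].
  apply: even_case => //; first exact: size_poly_of_coefs.
    by move=> j; have [] := hq j.
  by move=> _ j; have [] := hq j.
apply: (for_generic_polys (q := zorbit_poly R n) (a0 := @sample_parameter R n)) => [j|a an hq].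
  by rewrite meval_zorbit_poly sample_zorbit_neq0.
apply: even_case => //; first exact: size_poly_of_coefs.
- move=> _; rewrite (shifted_coef_ord _ ord_max) /=.
  by rewrite (gtn_eqF n0) subr0.
- by move=> j; rewrite -meval_zorbit_poly.
by move=> e; rewrite e in n0.
Qed.

Lemma odd_generic (R : realType) (n : nat) : odd n ->
  for_generic_parameters (fun a : 'I_n.+1 -> R[i] =>
    cvgn (degree_roots (poly_of_coefs a)) /\
    largest_root ('X^3 - n%:R *: 'X^2 - n.+1%:R *: 'X - 1)
      (degree_complexity (poly_of_coefs a))).
Proof.
move=> n_odd; have n0 : (0 < n)%N by case: n n_odd.
(* The condition excluding u = -1 at y = infinity concerns only n = 1; otherwise the constant 1
   takes its place. *)
pose k1 := fun j => if n == 1%N then kappa_poly R n *+ j + 1 else 1.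
have k1E a j : meval a (k1 j) =
    if n == 1%N then odd_kappa n (shifted_coef (poly_of_coefs a)) *+ j + 1 else 1.
  by rewrite /k1; case: ifP; rewrite !(meval_kappa_poly, mevalD, mevalMn, meval1).
apply: (for_generic_polys
    (q := fun j => zorbit_poly R n j * (kappa_poly R n *+ j.+1 * k1 j))
    (a0 := @sample_parameter R n)) => [j|a an hq].
  rewrite !(k1E, meval_zorbit_poly, meval_kappa_poly, mevalM, mevalMn).
  pose c := shifted_coef (poly_of_coefs (@sample_parameter R n)).
  have cn : c n = 1.
    rewrite /c (shifted_coef_ord _ ord_max) /sample_parameter /= eqxx.
    by rewrite (gtn_eqF n0) subr0.
  have [kap kap1] : odd_kappa n c != 0 /\ (n = 1%N -> odd_kappa n c = - 5%:R).
    rewrite /odd_kappa cn; have [n1|n1] := eqVneq n 1%N.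
      have -> : c n.-1 = - 2%:R.
        by rewrite n1 /c (shifted_coef_ord _ ord0) /sample_parameter /=; ring.
      rewrite n1 [nat_of_bool _]/=.
      have -> : (- 2%:R *+ 2 + 1 - 1 *+ 1 - 1%:R : R[i]) = - 5%:R by ring.
      by rewrite oppr_eq0 pnatr_eq0.
    have n1n : (n.-1 < n.+1)%N by rewrite ltnS leq_pred.
    have -> : c n.-1 = 0.
      rewrite /c (shifted_coef_ord _ (Ordinal n1n)) /sample_parameter /=.
      have -> : (n.-1 == 0%N) = false by lia.
      have -> : (n.-1 == n) = false by lia.
      by rewrite subr0.
    rewrite mul0rn add0r subr0; split; last by move/eqP: n1.
    by apply: (@natrB_neq0 R 1 n); rewrite eq_sym.
  rewrite mulf_neq0 ?sample_zorbit_neq0 // mulf_neq0 //.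
    by rewrite -mulr_natr mulf_neq0 // pnatr_eq0.
  have [n1|_] := eqVneq n 1%N; last exact: oner_neq0.
  rewrite -/c (kap1 n1); have -> : (- 5%:R *+ j + 1 : R[i]) = 1%:R - (5 * j)%:R.
    by rewrite natrM -mulr_natr; ring.
  by apply: natrB_neq0; apply/eqP; lia.
pose c := shifted_coef (poly_of_coefs a).
have {}hq j : [/\ zorbit c j != 0, odd_kappa n c *+ j.+1 != 0 & (n = 1%N -> odd_kappa n c *+ j + 1 != 0)].
  have := hq j; rewrite !(k1E, meval_zorbit_poly, meval_kappa_poly, mevalM, mevalMn).
  rewrite !mulf_eq0 !negb_or => /and3P[h1 h2 h3]; split=> // n1.
  by move: h3; rewrite (introT eqP n1).
apply: odd_case => //; first exact: size_poly_of_coefs.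
- by rewrite (shifted_coef_ord _ ord_max) /= (gtn_eqF n0) subr0.
- by move=> j; have [] := hq j.
- by move=> j; have [] := hq j.
by move=> n1 j; have [_ _] := hq j; apply.
Qed.

Theorem theorem1 (R : realType) (n : nat) :
  (~~ odd n ->
     for_generic_parameters (fun a : 'I_n.+1 -> R[i]%C =>
       cvgn (degree_roots (poly_of_coefs a)) /\
       largest_root ('X^2 - n.+1%:R *: 'X - 1)
         (degree_complexity (poly_of_coefs a)))) /\
  (odd n ->
     for_generic_parameters (fun a : 'I_n.+1 -> R[i]%C =>
       cvgn (degree_roots (poly_of_coefs a)) /\
       largest_root ('X^3 - n%:R *: 'X^2 - n.+1%:R *: 'X - 1)
         (degree_complexity (poly_of_coefs a)))).
Proof. by split; [exact: even_generic | exact: odd_generic]. Qed.
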